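(* Let $D$ be a division ring with center $F$, and let $N$ be a subnormal subgroup of $D^*$ containing a non-abelian solvable subgroup. If the transcendence degree of $F$ over its prime subfield $\mathbb{P}$ is infinite, then $N$ contains a non-abelian free subgroup.
   Context: $D^*$ denotes the multiplicative group of nonzero elements of $D$. A subgroup $N$ of a group $G$ is subnormal if there is a finite series $N=N_n\triangleleft N_{n-1}\triangleleft\cdots\triangleleft N_0=G$, each term being normal in the next larger one. *)

(* Defs.v *)
From HB Require Import structures.
From mathcomp Require Import all_boot all_algebra.
From mathcomp Require Import boolp classical_sets cardinality.
From mathcomp Require Import mpoly.

Set Implicit Arguments.
Unset Strict Implicit.
Unset Printing Implicit Defensive.

Import GRing.Theory.

Local Open Scope classical_set_scope.

(* A subgroup of a possibly infinite group is a set closed under the group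
   operations: boolean predicates would only give the decidable subgroups. *)
Section Groups.
Local Open Scope group_scope.
Variable G : groupType.
Implicit Types (A B H N X : set G).

Definition is_subgroup H : Prop :=
  [/\ H 1, forall x y, H x -> H y -> H (x * y) & forall x, H x -> H x^-1].

Definition generated A : set G := smallest is_subgroup A.

Definition abelian_set H : Prop := forall x y, H x -> H y -> commute x y.

Definition is_normal N H : Prop :=
  [/\ is_subgroup N, is_subgroup H, N `<=` H
    & forall x y, N x -> H y -> N (x ^ y)].

Definition subnormal N : Prop :=
  exists (n : nat) (S : nat -> set G),
    [/\ S 0%N = setT, S n = N
      & forall i : nat, (i < n)%N -> is_normal (S i.+1) (S i)].

Definition derived H : set G :=
  generated [set z | exists x y, [/\ H x, H y & z = [~ x, y]]].

Definition solvable_set H : Prop := exists n : nat, iter n derived H = [set 1].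

(* A word is a sequence of letters; (x, false) stands for x and (x, true) for
   x^-1. A word is reduced when no letter is next to its formal inverse. *)
Definition word_eval (w : seq (G * bool)) : G :=
  \prod_(l <- w) (if l.2 then l.1^-1 else l.1).

Definition reduced (w : seq (G * bool)) : bool :=
  sorted (fun l l' => ~~ ((l.1 == l'.1) && (l.2 != l'.2))) w.

Definition free_basis X H : Prop :=
  generated X = H /\
  forall w : seq (G * bool),
    (forall l, l \in w -> X l.1) -> reduced w -> w <> [::] -> word_eval w <> 1.

Definition is_free H : Prop := exists X, free_basis X H.

End Groups.

Section Fields.
Local Open Scope ring_scope.
Variable L : fieldType.
Implicit Types (K B : set L).

(* Closure under division suffices for products since x * y = x / (1 / y). *)
Definition is_subfield K : Prop :=
  [/\ K 1, forall x y, K x -> K y -> K (x - y)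
    & forall x y, K x -> K y -> K (x / y)].

Definition prime_subfield : set L := smallest is_subfield set0.

Definition adjoin K B : set L := smallest is_subfield (K `|` B).

Definition algebraic_over K (x : L) : Prop :=
  exists p : {poly L}, [/\ p != 0, forall i : nat, K p`_i & root p x].

Definition alg_independent K B : Prop :=
  forall (n : nat) (t : 'I_n -> L) (p : {mpoly L[n]}),
    injective t -> (forall i, B (t i)) ->
    (forall m, K p@_m) ->
    p.@[t] = 0 -> p = 0.

Definition transcendence_basis K B : Prop :=
  alg_independent K B /\ forall x, algebraic_over (adjoin K B) x.

(* All transcendence bases have the same cardinality, the transcendence
   degree. *)
Definition infinite_trdeg K : Prop :=
  exists B, transcendence_basis K B /\ infinite_set B.

End Fields.

Arguments prime_subfield : clear implicits.

HB.mixin Record UnitRing_isDivisionRing D of GRing.UnitRing D := {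
  nonzero_unit : GRing.field_axiom D
}.

#[short(type="divisionRingType")]
HB.structure Definition DivisionRing :=
  { D of UnitRing_isDivisionRing D & GRing.UnitRing D }.

Section NonzeroGroup.
Local Open Scope ring_scope.
Variable D : divisionRingType.

Record nonzero := Nonzero { nonzero_val : D; nonzeroP : nonzero_val != 0 }.

HB.instance Definition _ := [isSub for nonzero_val].
HB.instance Definition _ := [Choice of nonzero by <:].

Implicit Types x y z : nonzero.

Fact nonzero_valU x : nonzero_val x \is a GRing.unit.
Proof. exact/nonzero_unit/nonzeroP. Qed.

Fact nonzero1_subproof : (1 : D) != 0. Proof. exact: oner_neq0. Qed.

Fact nonzeroM_subproof x y : nonzero_val x * nonzero_val y != 0.
Proof.
by apply/eqP => xy0; have := unitr0 D; rewrite -xy0 unitrMr ?nonzero_valU.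
Qed.

Fact nonzeroV_subproof x : (nonzero_val x)^-1 != 0.
Proof. by rewrite invr_eq0 nonzeroP. Qed.

Definition nonzero1 := Nonzero nonzero1_subproof.
Definition nonzeroM x y := Nonzero (nonzeroM_subproof x y).
Definition nonzeroV x := Nonzero (nonzeroV_subproof x).

Fact nonzeroMA : associative nonzeroM.
Proof. by move=> x y z; apply/val_inj/mulrA. Qed.
Fact nonzero1M : left_id nonzero1 nonzeroM.
Proof. by move=> x; apply/val_inj/mul1r. Qed.
Fact nonzeroM1 : right_id nonzero1 nonzeroM.
Proof. by move=> x; apply/val_inj/mulr1. Qed.
Fact nonzeroVM : left_inverse nonzero1 nonzeroV nonzeroM.
Proof. by move=> x; apply/val_inj/mulVr/nonzero_valU. Qed.
Fact nonzeroMV : right_inverse nonzero1 nonzeroV nonzeroM.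
Proof. by move=> x; apply/val_inj/mulrV/nonzero_valU. Qed.

HB.instance Definition _ :=
  isGroup.Build nonzero nonzeroMA nonzero1M nonzeroM1 nonzeroVM nonzeroMV.

End NonzeroGroup.

Section Center.
Local Open Scope ring_scope.
Variable D : divisionRingType.

Definition central : {pred D} := fun x => `[< forall y : D, x * y = y * x >].

Fact central_divring_closed : divring_closed central.
Proof.
have cP x : reflect (forall y : D, x * y = y * x) (x \in central).
  exact: asboolP.
split.
- by apply/cP => y; rewrite mul1r mulr1.
- by move=> x y /cP cx /cP cy; apply/cP => z; rewrite mulrBl mulrBr cx cy.
move=> x y /cP cx /cP cy; apply/cP => z.
have -> : x / y * z = x * (z / y).
  rewrite -mulrA; congr (_ * _).
  have [->|/nonzero_unit Uy] := eqVneq y 0; first by rewrite invr0 mulr0 mul0r.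
  by apply: (mulrI Uy); rewrite mulrA divrr // mul1r mulrA cy mulrK.
by rewrite cx -!mulrA -cx.
Qed.

HB.instance Definition _ := GRing.isDivringClosed.Build D central
  central_divring_closed.

Record center := Center { center_val : D; centerP : center_val \in central }.

HB.instance Definition _ := [isSub for center_val].
HB.instance Definition _ := [Choice of center by <:].
HB.instance Definition _ := [SubChoice_isSubUnitRing of center by <:].

Fact center_mulC : commutative (@GRing.mul center).
Proof.
by move=> x y; apply/val_inj; rewrite !rmorphM; apply: (asboolW (centerP x)).
Qed.

HB.instance Definition _ := GRing.PzRing_hasCommutativeMul.Build center
  center_mulC.

Fact center_field : GRing.field_axiom center.
Proof. by move=> x; rewrite -(inj_eq val_inj) rmorph0 => /nonzero_unit. Qed.

HB.instance Definition _ := GRing.ComUnitRing_isField.Build center center_field.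

End Center.

(* Main.v *)
(* From a non-abelian solvable subgroup one extracts [a] and [y] in [N] with
   [ay <> ya] such that all conjugates [a_i = y^i a y^-i] commute; let [phi] be
   conjugation by [y]. Since the centre [F] has infinite transcendence degree, it
   contains elements [s1], [s2], [t] that are successively transcendental over
   the commutative field [K] generated by the [a_i] and the powers of [y]
   commuting with [a]: otherwise, by the exchange property of algebraic
   dependence, the whole orbit of [a] would be algebraic over finitely many
   elements. Put [L = K(s1, s2)], [Y = t y] and [Delta = 1 - Y]; the powers of [Y]
   are left independent over [L].

   Repeated commutators of [s1 - a] with [y] give [A] in [N], lying in [L], such
   that [A / phi A] is not a root of unity. With [f = (s2 - a_0) / (s2 - a_1)], the
   pair [Delta^-1 A Delta], [f] is free: [Delta^-1 A^k Delta = c + Delta^-1 g] with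
   [g = A^k - phi^-1 A^k], so a word in the pair expands into iterated sums whose
   leading term [Delta^-1 b_1 Delta^-1 b_2 ...] has letters [b = g f^l]. Such a term
   cannot be shortened when no [b] has the form [u - phi u] with [u] in [L], and
   this holds because, up to cancellation, [b] has a pole in [s2] at a single
   point of the orbit of [a].

   Conjugating, [A] forms a free pair with some [h_0] in [D^*], and then
   [h_(j+1) = h_j^-1 A h_j] descends along the subnormal series to [N] while
   [(A, h_j)] stays free. *)

Require Import Defs.
From HB Require Import structures.
From mathcomp Require Import all_boot all_order all_algebra.
From mathcomp Require Import boolp classical_sets cardinality.
From mathcomp Require Import mpoly.
From mathcomp Require Import zify.

Set Implicit Arguments.
Unset Strict Implicit.
Unset Printing Implicit Defensive.

Import Order.TTheory GRing.Theory Num.Theory.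

Local Open Scope classical_set_scope.
Local Open Scope ring_scope.

(** * Algebraic closure as a pregeometry *)

Section SubfieldPred.
Variables (F : fieldType) (K : set F).
Hypothesis K_subfield : is_subfield K.

(** The proof of [is_subfield K] is an argument so that the division ring structure can be declared
    on the predicate. *)
Definition subfield_pred of is_subfield K : {pred F} := fun x => `[< K x >].

Lemma subfieldP x : reflect (K x) (x \in subfield_pred K_subfield).
Proof. exact: asboolP. Qed.

Fact subfield_divring_closed : divring_closed (subfield_pred K_subfield).
Proof.
have [K1 KB KV] := K_subfield.
split=> [|x y /subfieldP Kx /subfieldP Ky|x y /subfieldP Kx /subfieldP Ky].
- exact/subfieldP.
- exact/subfieldP/KB.
- exact/subfieldP/KV.
Qed.

HB.instance Definition _ := GRing.isDivringClosed.Build F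
  (subfield_pred K_subfield) subfield_divring_closed.

Record subfield_type :=
  Subfield { subfield_val : F;
             subfield_valP : subfield_val \in subfield_pred K_subfield }.

Local Notation T := subfield_type.
HB.instance Definition _ := [isSub of T for @subfield_val].
HB.instance Definition _ := [Choice of T by <:].
HB.instance Definition _ := [SubChoice_isSubComUnitRing of T by <:].
HB.instance Definition _ := [SubComUnitRing_isSubIntegralDomain of T by <:].
HB.instance Definition _ := [SubIntegralDomain_isSubField of T by <:].

Lemma algebraic_overP x : algebraic_over K x <-> algebraicOver (val : T -> F) x.
Proof.
split=> [[p [p0 Kp px]]|[p p0 px]].
  exists (\poly_(i < size p) (insubd (0 : T) p`_i)); last first.
    have -> : map_poly val (\poly_(i < size p) (insubd (0 : T) p`_i)) = p => //.
    apply/polyP=> i; rewrite coef_map coef_poly /=.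
    case: ltnP => [_|le]; last by rewrite nth_default // rmorph0.
    by rewrite insubdK //; apply/subfieldP/Kp.
  apply: contra_neq p0 => p0; apply/polyP=> i.
  have := congr1 (fun q : {poly T} => val q`_i) p0.
  rewrite coef_poly !coef0 rmorph0; case: ltnP => [_|le _]; last first.
    by rewrite nth_default.
  by rewrite insubdK //; apply/subfieldP/Kp.
exists (map_poly val p); split=> //; first by rewrite map_poly_eq0.
by move=> i; rewrite coef_map /=; apply/subfieldP/subfield_valP.
Qed.

End SubfieldPred.

Section AlgebraicClosure.
Variable F : fieldType.
Implicit Types (K X Y : set F) (x y : F).

Lemma smallest_subfield X : is_subfield (smallest (@is_subfield F) X).
Proof.
split.
- by move=> M [[]].
- move=> x y Ax Ay M [sM AM]; have [_ MB _] := sM.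
  by apply: MB; [exact: Ax|exact: Ay].
move=> x y Ax Ay M [sM AM]; have [_ _ MV] := sM.
by apply: MV; [exact: Ax|exact: Ay].
Qed.

Lemma adjoin_subfield K X : is_subfield (adjoin K X).
Proof. exact: smallest_subfield. Qed.

Lemma adjoin_min K X M : is_subfield M -> K `<=` M -> X `<=` M ->
  adjoin K X `<=` M.
Proof. by move=> sM KM XM x; apply; split=> // y [/KM|/XM]. Qed.

Lemma sub_adjoinl K X : K `<=` adjoin K X.
Proof. by move=> x Kx M [_ KX]; apply: KX; left. Qed.

Lemma sub_adjoinr K X : X `<=` adjoin K X.
Proof. by move=> x Kx M [_ KX]; apply: KX; right. Qed.

Lemma algebraic_overS K K' x : K `<=` K' -> algebraic_over K x ->
  algebraic_over K' x.
Proof. by move=> sKK' [p [p0 Kp px]]; exists p; split=> // i; apply/sKK'/Kp. Qed.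

(** [adjoin set0 X] is the field generated by [X], prime field included; [acl] is the closure
    operator of the pregeometry. *)
Definition acl X : set F := [set x | algebraic_over (adjoin set0 X) x].

Lemma acl_subfield X : is_subfield (acl X).
Proof.
have sX := adjoin_subfield set0 X.
split.
- by apply/(algebraic_overP sX); apply: algebraic1.
- move=> x y /(algebraic_overP sX) ? /(algebraic_overP sX) ?.
  by apply/(algebraic_overP sX)/algebraic_sub.
- move=> x y /(algebraic_overP sX) ? /(algebraic_overP sX) ?.
  by apply/(algebraic_overP sX)/algebraic_div.
Qed.

Lemma sub_algebraic_over K x : is_subfield K -> K x -> algebraic_over K x.
Proof.
move=> sK Kx; apply/(algebraic_overP sK).
have xS : x \in subfield_pred sK by apply/subfieldP.
exact: (algebraic_id (val : subfield_type sK -> F) (Subfield xS)).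
Qed.

Lemma adjoin_sub_acl X : adjoin set0 X `<=` acl X.
Proof. by move=> x; apply: sub_algebraic_over; exact: adjoin_subfield. Qed.

Lemma sub_acl X : X `<=` acl X.
Proof. by move=> x Xx; apply: adjoin_sub_acl; apply: sub_adjoinr. Qed.

(** Transitivity of algebraicity: over a field algebraic means integral, and a root of a nonzero
    polynomial with integral coefficients is again integral. *)
Lemma algebraic_over_acl X x : algebraic_over (acl X) x -> acl X x.
Proof.
move=> [p [p0 Xp px]]; have sX := adjoin_subfield set0 X.
apply/(algebraic_overP sX)/integral_algebraic.
apply: (integral_root p0 px); apply/integral_poly => i.
exact/integral_algebraic/(algebraic_overP sX)/Xp.
Qed.

Lemma acl_min X Y : X `<=` acl Y -> acl X `<=` acl Y.
Proof.
move=> XY x aclx; apply: algebraic_over_acl; apply: algebraic_overS aclx.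
by apply: adjoin_min => //; exact: acl_subfield.
Qed.

Lemma aclS X Y : X `<=` Y -> acl X `<=` acl Y.
Proof. by move=> XY; apply: acl_min; apply: (subset_trans XY); exact: sub_acl. Qed.

Section SimpleExtension.
Variables (K : set F) (sK : is_subfield K) (y : F).
Local Notation S := (subfield_pred sK).

Definition fraction_at : set F := [set x | exists p q : {poly F},
  [/\ p \is a polyOver S, q \is a polyOver S, q.[y] != 0 & x = p.[y] / q.[y]]].

Lemma fraction_at_subfield : is_subfield fraction_at.
Proof.
split.
- by exists 1, 1; rewrite !rpred1 !hornerC oner_eq0 divr1.
- move=> _ _ [p [q [pS qS q0 ->]]] [p' [q' [p'S q'S q'0 ->]]].
  exists (p * q' - p' * q), (q * q'); split; rewrite ?rpredB ?rpredM //.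
    by rewrite hornerM mulf_neq0.
  by rewrite -mulNr addf_div // !hornerE mulNr.
move=> _ _ [p [q [pS qS q0 ->]]] [p' [q' [p'S q'S q'0 ->]]].
have [p'0|p'0] := eqVneq p'.[y] 0.
  exists 0, 1; rewrite rpred0 rpred1 !hornerC oner_eq0 p'0 mul0r invr0 mulr0.
  by rewrite mul0r.
exists (p * q'), (q * p'); split; rewrite ?rpredM //.
  by rewrite hornerM mulf_neq0.
by rewrite invf_div mulf_div !hornerE.
Qed.

Lemma fraction_at_base x : K x -> fraction_at x.
Proof.
move=> Kx; exists x%:P, 1; rewrite polyOverC rpred1 !hornerC oner_eq0 divr1.
by split=> //; apply/subfieldP.
Qed.

Lemma fraction_at_gen : fraction_at y.
Proof. by exists 'X, 1; rewrite polyOverX rpred1 hornerX hornerC oner_eq0 divr1. Qed.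

Lemma adjoin1_fraction x : adjoin K [set y] x -> fraction_at x.
Proof.
apply: adjoin_min => // [|z /fraction_at_base//|z ->]; last exact: fraction_at_gen.
exact: fraction_at_subfield.
Qed.

Lemma polyOver_adjoin1 p : p \is a polyOver S -> adjoin K [set y] p.[y].
Proof.
have sA := adjoin_subfield K [set y] => pS.
suff : p.[y] \in subfield_pred sA by move/subfieldP.
rewrite horner_coef rpred_sum // => i _; rewrite rpredM ?rpredX //.
  move/polyOverP: pS => /(_ i) /subfieldP Ki; apply/subfieldP; exact: sub_adjoinl Ki.
by apply/subfieldP; apply: sub_adjoinr.
Qed.

Lemma common_denominator n (c : nat -> F) : (forall i, fraction_at (c i)) ->
  exists2 d, d != 0 & exists r : nat -> {poly F},
    (forall i, r i \is a polyOver S) /\ forall i, (i < n)%N -> (r i).[y] = d * c i.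
Proof.
(* The denominator is kept as a polynomial over [K], because the induction multiplies it into the
   numerator of the next fraction. *)
move=> cP; suff [d [dS d0 [r [rS rE]]]] : exists d, [/\ d \is a polyOver S, d.[y] != 0
    & exists r : nat -> {poly F},
    (forall i, r i \is a polyOver S) /\ forall i, (i < n)%N -> (r i).[y] = d.[y] * c i].
  by exists d.[y] => //; exists r.
elim: n => [|n [d [dS d0 [r [rS rE]]]]].
  exists 1; rewrite rpred1 hornerC oner_eq0; split=> //.
  by exists (fun=> 0); split=> // i; rewrite rpred0.
have [p [q [pS qS q0 cn]]] := cP n.
exists (d * q); rewrite hornerM mulf_neq0 // rpredM //; split=> //.
exists (fun i => if i == n then d * p else r i * q); split=> [i|i].
  by case: eqP => _; rewrite rpredM.
rewrite ltnS leq_eqVlt; have [->|_ /= lti] := eqVneq.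
  by rewrite hornerM cn [_ / _]mulrC mulrA mulfK.
by rewrite hornerM rE // mulrAC.
Qed.

End SimpleExtension.

(** Clearing denominators in a relation for [x] over [K(y)] gives a nonzero polynomial in two
    variables over [K]. Regrouped by powers of [y], it has a coefficient that is a nonzero
    polynomial over [K], which cannot vanish at [x]. *)
Lemma exchange_algebraic K x y : is_subfield K ->
  algebraic_over (adjoin K [set y]) x -> ~ algebraic_over K x ->
  algebraic_over (adjoin K [set x]) y.
Proof.
move=> sK.
move=> [P [P0 KP Px]] ntr.
have [d d0 [r [rS rE]]] :=
  common_denominator (size P) (fun i => adjoin1_fraction sK (KP i)).
(* The outer variable of [Phi] stands for [x] and the inner one for [y]; [Q] swaps them and puts [x]
   for the inner one. *)
pose Phi := \poly_(i < size P) r i.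
have evPhi : map_poly (horner_eval y) Phi = d *: P.
  apply/polyP=> i; rewrite coef_map coefZ coef_poly; case: ltnP => [lti|lei].
    by rewrite /= /horner_eval rE.
  by rewrite /= /horner_eval horner0 nth_default // mulr0.
pose Q := map_poly (horner_eval x) (swapXY Phi).
exists Q; split.
- apply: contraPneq ntr => Q0; have Phi0 : swapXY Phi != 0.
    rewrite swapXY_eq0; apply: contra_neq P0 => Phi0; move/eqP: evPhi.
    by rewrite Phi0 rmorph0 eq_sym scaler_eq0 (negPf d0) => /eqP.
  have [j Phij0] : exists j, (swapXY Phi)`_j != 0.
    exists (size (swapXY Phi)).-1; rewrite -lead_coefE lead_coef_eq0.
    by [].
  case; exists (swapXY Phi)`_j; split=> // [i|].
    rewrite coef_swapXY coef_poly; case: ifP => _; last first.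
      by rewrite coef0; apply/(subfieldP sK); rewrite rpred0.
    by have /polyOverP/(_ j)/subfieldP := rS i.
  have := congr1 (fun q : {poly F} => q`_j) Q0.
  by rewrite coef_map coef0 /= /horner_eval => /eqP; rewrite rootE.
- move=> j; rewrite coef_map; apply: (polyOver_adjoin1 (sK := sK)).
  apply/polyOverP => i; rewrite coef_swapXY coef_poly; case: ifP => _.
    by have /polyOverP/(_ j) := rS i.
  by rewrite coef0 rpred0.
rewrite rootE /Q -horner_swapXY swapXYK.
have := horner2_swapXY Phi y x => <-.
by rewrite horner_swapXY evPhi hornerZ (rootP Px) mulr0.
Qed.

Lemma acl_setU1 X y x :
  acl (X `|` [set y]) x <-> algebraic_over (adjoin (adjoin set0 X) [set y]) x.
Proof.
have sA := adjoin_subfield set0 (X `|` [set y]).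
have sB := adjoin_subfield (adjoin set0 X) [set y].
split; apply: algebraic_overS; apply: adjoin_min => //.
- move=> z [Xz|->]; last exact: sub_adjoinr.
  by apply: sub_adjoinl; apply: sub_adjoinr.
- by apply: adjoin_min => // z Xz; apply: sub_adjoinr; left.
by move=> _ ->; apply: sub_adjoinr; right.
Qed.

Lemma acl_exchange X x y :
  acl (X `|` [set y]) x -> ~ acl X x -> acl (X `|` [set x]) y.
Proof.
move=> /acl_setU1 ax nax; apply/acl_setU1; apply: exchange_algebraic => //.
exact: adjoin_subfield.
Qed.

End AlgebraicClosure.

Lemma setU1_rcons (T : choiceType) (s : seq T) (x : T) :
  [set` s] `|` [set x] = [set` rcons s x].
Proof.
apply/seteqP; split=> z /=; rewrite mem_rcons inE.
  by case=> [->|->]; rewrite ?eqxx ?orbT.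
by case/predU1P => [->|zs]; [right|left].
Qed.

(** * Finite character and Steinitz exchange *)

Section Exchange.
Variable F : fieldType.
Implicit Types (X Y : set F) (s : seq F) (x y : F).

(** The elements generated by finite subfamilies already form a subfield containing [X]. *)
Lemma adjoin_finite X x : adjoin set0 X x ->
  exists s, [set` s] `<=` X /\ adjoin set0 [set` s] x.
Proof.
pose M : set F := [set x | exists s, [set` s] `<=` X /\ adjoin set0 [set` s] x].
have catX s t : [set` s] `<=` X -> [set` t] `<=` X -> [set` s ++ t] `<=` X.
  by move=> sX tX z /=; rewrite mem_cat => /orP[/sX|/tX].
have adjS s t : {subset s <= t} -> adjoin set0 [set` s] `<=` adjoin set0 [set` t].
  move=> st; apply: adjoin_min => //; first exact: adjoin_subfield.
  by move=> z zs; apply: sub_adjoinr; apply: st.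
have adjl s t : adjoin set0 [set` s] `<=` adjoin set0 [set` s ++ t].
  by apply: adjS => z zs; rewrite mem_cat zs.
have adjr s t : adjoin set0 [set` t] `<=` adjoin set0 [set` s ++ t].
  by apply: adjS => z zs; rewrite mem_cat zs orbT.
suff : adjoin set0 X `<=` M by apply.
apply: adjoin_min; [|by []|]; last first.
  move=> z Xz; exists [:: z]; split; first by move=> t; rewrite /= inE => /eqP ->.
  by apply: sub_adjoinr; rewrite /= inE.
split.
- exists [::]; split=> //.
  by have [A1 _ _] := adjoin_subfield set0 [set` [::] : seq F]; exact: A1.
- move=> z t [s1 [s1X zs1]] [s2 [s2X ts2]].
  exists (s1 ++ s2); split; first exact: catX.
  have [_ sB _] := adjoin_subfield set0 [set` s1 ++ s2].
  by apply: sB; [exact: adjl zs1|exact: adjr ts2].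
- move=> z t [s1 [s1X zs1]] [s2 [s2X ts2]].
  exists (s1 ++ s2); split; first exact: catX.
  have [_ _ sV] := adjoin_subfield set0 [set` s1 ++ s2].
  by apply: sV; [exact: adjl zs1|exact: adjr ts2].
Qed.

Lemma acl_finite X x : acl X x -> exists s, [set` s] `<=` X /\ acl [set` s] x.
Proof.
move=> [p [p0 Xp px]].
suff [s [sX sp]] : exists s, [set` s] `<=` X /\ forall i, adjoin set0 [set` s] p`_i.
  by exists s; split=> //; exists p.
suff [s [sX sp]] : exists s, [set` s] `<=` X /\
    forall i, (i < size p)%N -> adjoin set0 [set` s] p`_i.
  exists s; split=> // i; have [/sp //|le] := ltnP i (size p).
  rewrite nth_default //; have [s1 sB _] := adjoin_subfield set0 [set` s].
  by rewrite -(subrr 1); apply: sB.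
elim: (size p) => [|n [s [sX sp]]]; first by exists [::].
have [t [tX tp]] := adjoin_finite (Xp n).
exists (s ++ t); split; first by move=> z /=; rewrite mem_cat => /orP[/sX|/tX].
have sub u : {subset u <= s ++ t} ->
    adjoin set0 [set` u] `<=` adjoin set0 [set` s ++ t].
  move=> us; apply: adjoin_min => //; first exact: adjoin_subfield.
  by move=> z zs; apply: sub_adjoinr; apply: us.
move=> i; rewrite ltnS leq_eqVlt => /predU1P[->|/sp].
  by move: tp; apply: sub => z zt; rewrite mem_cat zt orbT.
by apply: sub => z zs; rewrite mem_cat zs.
Qed.

(** Independence is read along the list, each entry avoiding the closure of [G] and its
    predecessors; this suits an exchange induction. *)
Fixpoint acl_independent (G : set F) (bs : seq F) : Prop :=
  if bs is b :: bs' then ~ acl G b /\ acl_independent (G `|` [set b]) bs' else True.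

Lemma acl_independent_size G bs s : acl_independent G bs ->
  [set` bs] `<=` acl (G `|` [set` s]) -> (size bs <= size s)%N.
Proof.
elim: bs G s => [//|b bs IHbs] G s /= [nGb ind] bss.
have : acl (G `|` [set` s]) b by apply: bss; rewrite /= mem_head.
(* [c] is the entry of [s] whose addition first brings [b] into the closure, so [c] can be exchanged
   for [b]. *)
have [s1 [c [s2 [es bc nb]]]] : exists s1 c s2, [/\ s = s1 ++ c :: s2,
    acl (G `|` [set` rcons s1 c]) b & ~ acl (G `|` [set` s1]) b].
  have : acl (G `|` [set` s]) b by apply: bss; rewrite /= mem_head.
  elim/last_ind: (s) => [|s' c IHs'] clb.
    case: nGb; move: clb; apply: aclS => z [//|/=]; by rewrite inE.
  have [cls'|ncls'] := pselect (acl (G `|` [set` s']) b); last first.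
    by exists s', c, [::]; rewrite cats1.
  have [s1 [d [s2 [-> db nb]]]] := IHs' cls'.
  by exists s1, d, (rcons s2 c); rewrite rcons_cat.
move=> _; rewrite es in bss *; rewrite size_cat /= addnS ltnS -size_cat.
apply: IHbs ind _; set Y := (_ `|` _).
have Gb z : G z -> acl Y z by move=> Gz; apply: sub_acl; left; left.
have bb : acl Y b by apply: sub_acl; left; right.
have s1b z : z \in s1 ++ s2 -> acl Y z by move=> zs; apply: sub_acl; right.
have cY : acl Y c.
  have /acl_exchange/(_ nb) : acl ((G `|` [set` s1]) `|` [set c]) b.
    move: bc; apply: aclS => z [Gz|/=]; first by left; left.
    by rewrite mem_rcons inE => /predU1P[->|zs1]; [right|left; right].
  apply: acl_min => z [[/Gb //|zs1]|->//].
  by apply: s1b; rewrite mem_cat zs1.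
move=> z zbs; have : acl (G `|` [set` s1 ++ c :: s2]) z.
  by apply: bss; rewrite /= inE zbs orbT.
apply: acl_min => t [/Gb //|/=]; rewrite mem_cat inE => /or3P[zs1|/eqP -> //|zs2].
  by apply: s1b; rewrite mem_cat zs1.
by apply: s1b; rewrite mem_cat zs2 orbT.
Qed.

End Exchange.

(** * From polynomial independence to independence for the closure *)

Section AlgebraicIndependence.
Variables (C : fieldType).

Lemma prime_subfieldP : is_subfield (prime_subfield C).
Proof. exact: smallest_subfield. Qed.

Local Notation S := (subfield_pred prime_subfieldP).

Section LastVariable.
Variables (s : seq C) (b : C).
Let n := size s.

Let pt (i : 'I_n.+1) : C := nth 0 (rcons s b) i.
(** The first [n] variables are specialised to [s] and the last one stays an indeterminate;
    evaluating [ev2] at [b] then amounts to evaluating at [pt]. *)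
Let var (i : 'I_n.+1) : {poly C} := if (i < n)%N then (pt i)%:P else 'X.
Local Notation ev2 := (mmap polyC var).

Lemma horner_ev2 (P : {mpoly C[n.+1]}) : (ev2 P).[b] = P.@[pt].
Proof.
rewrite /mmap /meval /mmap horner_sum; apply: eq_bigr => m _.
rewrite hornerM hornerC /mmap1 horner_prod; congr (_ * _).
apply: eq_bigr => i _; rewrite horner_exp; congr (_ ^+ _); rewrite /var.
case: ltnP => [_|le]; first by rewrite hornerC.
rewrite hornerX /pt; have -> : nat_of_ord i = n.
  by apply/eqP; rewrite eqn_leq le -ltnS ltn_ord.
by rewrite nth_rcons /n ltnn eqxx.
Qed.

(** Elements of the field generated by [s] are quotients of polynomials over the prime field
    evaluated at [s]: [Q] yields the denominator [d], and [P] the numerator. *)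
Lemma adjoin_mpoly_fraction x : adjoin set0 [set` s] x ->
  exists (P Q : {mpoly C[n.+1]}) (d : C),
    [/\ P \is a mpolyOver n.+1 S, Q \is a mpolyOver n.+1 S, d != 0,
      ev2 Q = d%:P & ev2 P = (d * x)%:P].
Proof.
pose M : set C := [set x | exists (P Q : {mpoly C[n.+1]}) (d : C),
    [/\ P \is a mpolyOver n.+1 S, Q \is a mpolyOver n.+1 S, d != 0,
      ev2 Q = d%:P & ev2 P = (d * x)%:P]].
suff : adjoin set0 [set` s] `<=` M by apply.
apply: adjoin_min; [|by []|].
  split.
  - by exists 1, 1, 1; rewrite !rpred1 oner_eq0 rmorph1 mulr1.
  - move=> y z [P [Q [d [PS QS d0 eQ eP]]]] [P' [Q' [d' [P'S Q'S d'0 eQ' eP']]]].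
    exists (P * Q' - P' * Q), (Q * Q'), (d * d'); split.
    + by rewrite rpredB ?rpredM.
    + by rewrite rpredM.
    + by rewrite mulf_neq0.
    + by rewrite rmorphM /= eQ eQ' polyCM.
    rewrite rmorphB !rmorphM /= eP eQ' eP' eQ -!polyCM -polyCB.
    by rewrite mulrBr -!mulrA [y * _]mulrC [z * _]mulrC [d' * (d * z)]mulrCA.
  move=> y z [P [Q [d [PS QS d0 eQ eP]]]] [P' [Q' [d' [P'S Q'S d'0 eQ' eP']]]].
  have [->|z0] := eqVneq z 0.
    exists 0, 1, 1; rewrite rpred0 rpred1 oner_eq0 !rmorph1 rmorph0 invr0.
    by rewrite !mulr0.
  exists (P * Q'), (Q * P'), (d * (d' * z)); split.
  - by rewrite rpredM.
  - by rewrite rpredM.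
  - by rewrite !mulf_neq0.
  - by rewrite rmorphM /= eQ eP' !polyCM.
  rewrite rmorphM /= eP eQ' -polyCM -!mulrA; congr (_ * _)%:P.
  by rewrite mulrC; congr (_ * _); rewrite mulrCA divff ?mulr1.
move=> z zs; have lti : (index z s < n)%N by rewrite index_mem.
pose i : 'I_n.+1 := Ordinal (ltnW lti : index z s < n.+1)%N.
exists 'X_i, 1, 1; split; rewrite ?rpred1 ?oner_eq0 ?rmorph1 ?mpolyOverX //.
rewrite mmapX mmap1U mul1r /var /= lti /pt /= nth_rcons lti.
by rewrite nth_index.
Qed.

Lemma adjoin_poly_mpoly (p : {poly C}) : (forall i, adjoin set0 [set` s] p`_i) ->
  exists (P : {mpoly C[n.+1]}) (d : C),
    [/\ P \is a mpolyOver n.+1 S, d != 0 & ev2 P = d *: p].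
Proof.
move=> pP; suff [P [Q [d [PS QS d0 _ eP]]]] : exists (P Q : {mpoly C[n.+1]}) (d : C),
    [/\ P \is a mpolyOver n.+1 S, Q \is a mpolyOver n.+1 S, d != 0, ev2 Q = d%:P
      & ev2 P = d *: \poly_(i < size p) p`_i].
  by exists P, d; rewrite eP coefK.
elim: (size p) => [|m [P [Q [d [PS QS d0 eQ eP]]]]].
  exists 0, 1, 1; rewrite rpred0 rpred1 oner_eq0 rmorph1 rmorph0 poly_def big_ord0.
  by rewrite scaler0.
have [P' [Q' [d' [P'S Q'S d'0 eQ' eP']]]] := adjoin_mpoly_fraction (pP m).
exists (P * Q' + P' * Q * 'X_ord_max ^+ m), (Q * Q'), (d * d'); split.
- by rewrite rpredD ?rpredM ?rpredX ?mpolyOverX.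
- by rewrite rpredM.
- by rewrite mulf_neq0.
- by rewrite rmorphM /= eQ eQ' polyCM.
rewrite rmorphD !rmorphM rmorphXn /= eP eQ' eP' eQ mmapX mmap1U /var /= ltnn.
rewrite !poly_def big_ord_recr /= scalerDr; congr (_ + _).
  by rewrite mulrC mul_polyC scalerA mulrC.
by rewrite -polyCM mul_polyC scalerA; congr (_ *: _); rewrite mulrAC [d * d']mulrC.
Qed.

(** A relation for [b] over the field of [s], once cleared of denominators, is a polynomial over the
    prime field vanishing at distinct elements of [B]. *)
Lemma alg_independent_not_algebraic (B : set C) :
    alg_independent (prime_subfield C) B -> uniq (rcons s b) ->
    [set` rcons s b] `<=` B -> ~ acl [set` s] b.
Proof.
move=> indB us sB [p [p0 sp pb]].
have [P [d [PS d0 eP]]] := adjoin_poly_mpoly sp.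
have P0 : P = 0.
  apply: (indB _ pt) => [i j eqij|i|m|].
  - apply/val_inj/eqP.
    rewrite -(nth_uniq 0 _ _ us) ?size_rcons ?(ltn_ord i) ?(ltn_ord j) //.
    exact/eqP.
  - by apply: (sB); rewrite /= mem_nth // size_rcons.
  - by have /mpolyOverP/(_ m)/subfieldP := PS.
  by rewrite -horner_ev2 eP hornerZ (rootP pb) mulr0.
move/eqP: eP; rewrite P0 rmorph0 eq_sym scaler_eq0 (negPf d0).
by rewrite (negPf p0).
Qed.
End LastVariable.

Lemma alg_independent_acl (B : set C) (r s : seq C) :
  alg_independent (prime_subfield C) B -> uniq (r ++ s) ->
  [set` r ++ s] `<=` B -> acl_independent [set` r] s.
Proof.
move=> indB; elim: s r => [//|b s IHs] r; rewrite -cat_rcons => urs rsB; split.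
  apply: alg_independent_not_algebraic indB _ _.
    by move: urs; rewrite cat_uniq => /andP[].
  by move=> z zr; apply: rsB; rewrite /= mem_cat zr.
by rewrite setU1_rcons; exact: IHs.
Qed.

End AlgebraicIndependence.

Section Morphisms.
Variables (E F : fieldType) (f : {rmorphism E -> F}).

Lemma acl_rmorph (X : set E) (Y : set F) x :
  (forall z, X z -> acl Y (f z)) -> acl X x -> acl Y (f x).
Proof.
move=> XY [p [p0 Xp px]]; apply: algebraic_over_acl.
have [s1 sB sV] := acl_subfield Y.
have sub : adjoin set0 X `<=` [set z | acl Y (f z)].
  apply: adjoin_min => //; split=> /=.
  - by rewrite rmorph1; exact: s1.
  - by move=> y z ? ?; rewrite rmorphB; exact: sB.
  - by move=> y z ? ?; rewrite fmorph_div; exact: sV.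
exists (map_poly f p); split; first by rewrite map_poly_eq0.
  by move=> i; rewrite coef_map; exact: (sub _ (Xp i)).
by rewrite fmorph_root.
Qed.

(** The field generated by the image is the image of the generated field, so the polynomial lifts
    coefficient by coefficient. *)
Lemma acl_preimage (X : set E) x : acl (f @` X) (f x) -> acl X x.
Proof.
move=> [p [p0 Xp px]].
have sub : adjoin set0 (f @` X) `<=` f @` adjoin set0 X.
  have [s1 sB sV] := adjoin_subfield set0 X.
  apply: adjoin_min => //.
    split.
    - by exists 1; rewrite ?rmorph1.
    - move=> _ _ [y Xy <-] [z Xz <-].
      by exists (y - z); rewrite ?rmorphB //; exact: sB.
    - move=> _ _ [y Xy <-] [z Xz <-].
      by exists (y / z); rewrite ?fmorph_div //; exact: sV.
  by move=> _ [y Xy <-]; exists y => //; exact: sub_adjoinr.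
have /choice[c cP] : forall i : nat, exists y, adjoin set0 X y /\ f y = p`_i.
  by move=> i; have [y Xy fy] := sub _ (Xp i); exists y.
have ep : map_poly f (\poly_(i < size p) c i) = p.
  apply/polyP=> i; rewrite coef_map coef_poly /=.
  case: ltnP => [_|le]; first by have [_ ->] := cP i.
  by rewrite rmorph0 nth_default.
exists (\poly_(i < size p) c i); split.
- by rewrite -(map_poly_eq0 f) ep.
- move=> i; rewrite coef_poly; case: ifP => _; first by have [] := cP i.
  have [s1 sB _] := adjoin_subfield set0 X.
  by rewrite -(subrr 1); exact: sB.
by rewrite -(fmorph_root f) ep.
Qed.
End Morphisms.

Section InfiniteTranscendence.
Variables (C F : fieldType) (iota : {rmorphism C -> F}).

Lemma infinite_set_seq (T : choiceType) (B : set T) n : infinite_set B ->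
  exists s : seq T, [/\ uniq s, [set` s] `<=` B & size s = n].
Proof.
move=> infB; elim: n => [|n [s [us sB ss]]]; first by exists [::].
have [x [Bx xs]] : exists x, B x /\ x \notin s.
  apply: contrapT => nx; apply: infB; apply: (sub_finite_set _ (finite_seq s)) => x Bx /=.
  by apply: contrapT => /negP xs; apply: nx; exists x.
exists (x :: s); rewrite /= xs us ss; split=> // z /=.
by rewrite inE => /predU1P[->|/sB].
Qed.

Lemma acl_independent_rmorph (r s : seq C) : acl_independent [set` r] s ->
  acl_independent [set` map iota r] (map iota s).
Proof.
have imE t : [set` map iota t] = iota @` [set` t].
  apply/seteqP; split=> z /=; first by move=> /mapP[y yt ->]; exists y.
  by case=> y yt <-; apply: map_f.
elim: s r => [//|b s IHs] r /= [nb ind]; split.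
  by rewrite imE => /acl_preimage.
by rewrite setU1_rcons -map_rcons; apply: IHs; rewrite -setU1_rcons.
Qed.

(** Otherwise [(size s).+1] elements of the infinite basis would have independent images inside the
    closure of [s]. *)
Lemma infinite_trdeg_not_finite (s : seq F) :
  infinite_trdeg (prime_subfield C) -> exists t, ~ acl [set` s] (iota t).
Proof.
move=> [B [[indB _] infB]]; apply: contrapT => nt.
have {}nt t : acl [set` s] (iota t) by apply: contrapT => h; apply: nt; exists t.
have [bs [ubs bsB sbs]] := infinite_set_seq (size s).+1 infB.
have := @alg_independent_acl C B [::] bs indB ubs bsB.
move=> /acl_independent_rmorph /acl_independent_size -/(_ s).
rewrite size_map sbs ltnn => h; suff : false by []; apply: h.
move=> z /= /mapP[t _ ->]; apply: aclS (nt t) => y ys; by right.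
Qed.
End InfiniteTranscendence.

(** * Fixed elements transcendental over a whole orbit *)

Section Window.
Variables (F : fieldType) (phi : int -> {rmorphism F -> F}).
Hypothesis phi0 : forall x, phi 0 x = x.
Hypothesis phiD : forall i j x, phi (i + j) x = phi i (phi j x).
Variable Fx : set F.
Hypothesis Fx_fixed : forall i x, Fx x -> phi i x = x.
Hypothesis Fx_infinite : forall s : seq F, exists t, Fx t /\ ~ acl [set` s] t.
Variable a : F.
Local Notation orbit := [set x | exists i, x = phi i a].

(* If every element of [Fx] were algebraic over the orbit of [a] and [s], a
   minimal window of the orbit witnessing this for one [t] would make the whole
   orbit algebraic over finitely many elements. *)
Lemma orbit_transcendental (s : seq F) : (forall i x, x \in s -> phi i x = x) ->
  exists t, Fx t /\ ~ acl (orbit `|` [set` s]) t.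
Proof.
move=> s_fixed; apply: contrapT => nt.
have {}nt t : Fx t -> acl (orbit `|` [set` s]) t.
  by move=> Fxt; apply: contrapT => h; apply: nt; exists t.
have [t [Fxt st]] := Fx_infinite s.
pose W d := [set` s] `|` [set x | exists2 i : nat, (i < d)%N & x = phi i%:Z a].
have finW d : exists l : seq F, W d `<=` [set` l].
  exists (s ++ [seq phi i%:Z a | i <- iota 0 d]) => x /= [xs|[i ltid ->]].
    by rewrite mem_cat xs.
  rewrite mem_cat; apply/orP; right; apply: (map_f (fun i : nat => phi i%:Z a)).
  by rewrite mem_iota.
have [d0 Wd0] : exists d, acl (W d) t.
  have [l [lsub lt]] := acl_finite (nt t Fxt).
  have [N NP] : exists N : nat, forall x, x \in l -> [set` s] x \/
      exists i : int, [/\ - N%:Z <= i, i < N%:Z & x = phi i a].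
    elim: l lsub {lt} => [|x l IHl] lsub; first by exists 0%N.
    have [y yl|N NP] := IHl; first by apply: lsub; rewrite /= inE yl orbT.
    have [] := lsub x (mem_head _ _).
      move=> [i ei]; exists (N + `|i|.+1)%N => y; rewrite inE => /predU1P[->|/NP].
        by right; exists i; split=> //; lia.
      by case=> [|[j [j1 j2 ej]]]; [left|right; exists j; split=> //; lia].
    by move=> xs; exists N => y; rewrite inE => /predU1P[->|/NP //]; left.
  (* Shifting by [N] fixes [t] and moves the indices from [-N, N) into the window of length 2N. *)
  exists (N + N)%N; rewrite -(Fx_fixed N%:Z Fxt); apply: (acl_rmorph _ lt) => z /NP.
  move=> [zs|[i [i1 i2 ->]]].
    by apply: sub_acl; left; rewrite /= s_fixed.
  apply: sub_acl; right; exists (absz (N%:Z + i)); first by lia.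
  by rewrite -phiD; congr (phi _ a); lia.
have exd : exists d, `[< acl (W d) t >] by exists d0; apply/asboolP.
(* Length 0 would leave [s] alone, excluded by the choice of [t]; the least length is thus e + 1. *)
case: (ex_minnP exd) => [[|e]] /asboolP Wt Wmin.
  by case: st; move: Wt; apply: aclS => x [//|[]].
have nWe : ~ acl (W e) t.
  by move=> /asboolP /Wmin; rewrite ltnn.
pose G := W e `|` [set t].
have GW x : W e x -> acl G x by move=> We; apply: sub_acl; left.
have Gs x : x \in s -> acl G x by move=> xs; apply: GW; left.
have Gt : acl G t by apply: sub_acl; right.
(* By minimality [t] can be exchanged for the last point of the window. *)
have Gtop : acl G (phi e%:Z a).
  apply: acl_exchange nWe; move: Wt; apply: aclS => x [xs|[i lti ->]].
    by left; left.
  move: lti; rewrite ltnS leq_eqVlt => /predU1P[->|lti]; first by right.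
  by left; right; exists i.
(* The window of indices 1 to e misses [t] too, being a shift of [W e]. Exchange expresses [a] by
   this window and [t]; shifting back by one reaches the point just before the window. *)
have Gbot : acl G (phi (-1) a).
  pose W1 := [set` s] `|` [set x | exists2 i : nat, (i < e)%N & x = phi i.+1%:Z a].
  have nW1 : ~ acl W1 t.
    move=> /(@acl_rmorph _ _ (phi (-1)) _ (W e)) W1t; apply: nWe.
    rewrite -(Fx_fixed (-1) Fxt); apply: W1t => z [zs|[i lti ->]]; apply: sub_acl.
      by left; rewrite /= s_fixed.
    by right; exists i => //; rewrite -phiD; congr (phi _ a); lia.
  have : acl (W1 `|` [set t]) a.
    apply: acl_exchange nW1; move: Wt; apply: aclS => x [xs|[[|i] lti ->]].
    - by left; left.
    - by right; rewrite /= phi0.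
    - by left; right; exists i.
  apply: acl_rmorph => z [[zs|[i lti ->]]|->].
  - by rewrite s_fixed //; exact: Gs.
  - by rewrite -phiD; apply: GW; right; exists i => //; congr (phi _ a); lia.
  - by rewrite Fx_fixed.
have G1 x : acl G x -> acl G (phi 1 x).
  apply: acl_rmorph => z [[zs|[i lti ->]]|->].
  - by rewrite s_fixed //; exact: Gs.
  - rewrite -phiD; have [eie|neq] := eqVneq i.+1 e.
      by have -> : 1 + i%:Z = e%:Z by lia.
    by apply: GW; right; exists i.+1; [lia|congr (phi _ a); lia].
  - by rewrite Fx_fixed.
have GN1 x : acl G x -> acl G (phi (-1) x).
  apply: acl_rmorph => z [[zs|[[|i] lti ->]]|->].
  - by rewrite s_fixed //; exact: Gs.
  - by rewrite phi0.
  - by rewrite -phiD; apply: GW; right; exists i; [lia|congr (phi _ a); lia].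
  - by rewrite Fx_fixed.
have Ga : acl G a.
  case: (e) Gtop GW => [|e'] Gtop GW; first by rewrite -(phi0 a).
  by apply: GW; right; exists 0%N; rewrite ?phi0.
have Gorb i : acl G (phi i a).
  case: i => n.
    elim: n => [|n IHn]; first by rewrite phi0.
    by have := G1 _ IHn; rewrite -phiD; congr (acl G (phi _ a)); lia.
  rewrite NegzE; elim: n => [|n IHn]; first exact: Gbot.
  by have := GN1 _ IHn; rewrite -phiD; congr (acl G (phi _ a)); lia.
(* All of [Fx] is now algebraic over the finite set formed by [W e] and [t]. *)
have [l lP] := finW e; have [t' [Fxt' []]] := Fx_infinite (t :: l).
have : acl G t'.
  by apply: acl_min (nt t' Fxt') => z [[i ->] //|zs]; exact: Gs.
apply: aclS => z [/lP zl|->]; rewrite /= inE ?eqxx //.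
by apply/orP; right.
Qed.
End Window.

(** * Rational functions over a field with a shift *)

(** If [e n.+1] is constant then [e n] is affine on the naturals; bounded by 2^n, it has slope 0,
    and one goes down to [e 0]. *)
Lemma bounded_difference_const (e : nat -> int -> int) n :
    (forall m i, e m.+1 i = e m i - e m (i - 1)) ->
    (forall i, `|e 0%N i| <= 1) ->
  (forall i, e n i = e n (i - 1)) -> forall i, e 0%N i = e 0%N (i - 1).
Proof.
move=> eS e0; have bnd m i : `|e m i| <= 2 ^+ m.
  elim: m i => [|m IHm] i; first exact: e0.
  rewrite eS exprS mulr_natl mulr2n.
  by apply: le_trans (ler_normB _ _) _; apply: lerD.
elim: n => [//|n IHn] en; apply: IHn.
have eC j : e n.+1 j%:Z = e n.+1 0.
  elim: j => [//|j <-]; rewrite en; congr (e n.+1 _); lia.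
have linear j : e n j%:Z = e n 0 + e n.+1 0 * j%:Z.
  elim: j => [|j IHj]; first by rewrite mulr0 addr0.
  have := eS n j.+1%:Z; rewrite eC; have -> : j.+1%:Z - 1 = j%:Z by lia.
  by rewrite IHj; lia.
(* Between 0 and 2 * 2^n + 1 a nonzero integer slope exceeds the variation 2 * 2^n that the bound
   allows. *)
have c0 : e n.+1 0 = 0.
  have := bnd n 0; have := bnd n (2 * 2 ^ n + 1)%N%:Z; rewrite linear.
  have -> : (2 : int) ^+ n = (2 ^ n)%N%:Z by rewrite -[RHS]natz natrX.
  move: (e n 0) (e n.+1 0) (2 ^ n)%N => x c N; nia.
have eC' i : e n.+1 i = e n.+1 0.
  case: i => j; first exact: eC.
  rewrite NegzE; elim: j => [|j IHj].
    by have := en 0; rewrite sub0r.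
  by rewrite -IHj [RHS]en; congr (e n.+1 _); lia.
by move=> i; have := eS n i; rewrite eC' c0; lia.
Qed.

Section ShiftedRationalFunctions.
Variables (F : fieldType) (phi : int -> {rmorphism F -> F}).
Hypothesis phi0 : forall x, phi 0 x = x.
Hypothesis phiD : forall i j x, phi (i + j) x = phi i (phi j x).
Variables (K : set F) (sK : is_subfield K).
Hypothesis phiK : forall i x, K x -> K (phi i x).
Variables (s a : F).
Hypothesis phi_s : forall i, phi i s = s.
Hypothesis s_transcendental : ~ algebraic_over K s.
Hypothesis Ka : K a.

Local Notation S := (subfield_pred sK).
Local Notation orb i := (phi i a).

Lemma transcendental_horner p : p \is a polyOver S -> p.[s] = 0 -> p = 0.
Proof.
move=> /polyOverP pS ps0; apply: contra_notP s_transcendental => /eqP p0.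
by exists p; split=> // [i|]; [apply/(subfieldP sK)/pS|apply/rootP].
Qed.

Lemma transcendental_horner_neq0 p : p \is a polyOver S -> p != 0 -> p.[s] != 0.
Proof. by move=> pS; apply: contra_neq; exact: transcendental_horner. Qed.

Lemma orbK i : K (orb i). Proof. exact: phiK. Qed.

Lemma polyOver_phi i p : p \is a polyOver S -> map_poly (phi i) p \is a polyOver S.
Proof.
move=> /polyOverP pS; apply/polyOverP => j; rewrite coef_map /=.
by apply/(subfieldP sK)/phiK/(subfieldP sK)/pS.
Qed.

Lemma horner_phi i p x : (map_poly (phi i) p).[phi i x] = phi i p.[x].
Proof. exact: horner_map. Qed.

Lemma horner_phi_s i p : (map_poly (phi i) p).[s] = phi i p.[s].
Proof. by rewrite -{1}(phi_s i) horner_map. Qed.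

Lemma neq0_horner (p : {poly F}) x : p.[x] != 0 -> p != 0.
Proof. by apply: contraNneq => ->; rewrite horner0. Qed.

(** The valuation at the point [s = al] as a relation: what remains after the power of [s - al] has
    neither zero nor pole there. *)
Definition order_at (al w : F) (z : int) : Prop := exists p q : {poly F},
  [/\ p \is a polyOver S /\ q \is a polyOver S, p.[al] != 0, q.[al] != 0
    & w = (s - al) ^ z * (p.[s] / q.[s])].

Lemma polyOver_XsubS al : K al -> 'X - al%:P \is a polyOver S.
Proof. by move=> Kal; rewrite polyOverXsubC; apply/subfieldP. Qed.

Lemma sub_transcendental_neq0 al : K al -> s - al != 0.
Proof.
move=> Kal; have := @transcendental_horner_neq0 ('X - al%:P).
by rewrite hornerXsubC; apply; rewrite ?polyXsubC_eq0 ?polyOver_XsubS.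
Qed.

(** As [s] is transcendental, comparing the two expressions gives a polynomial identity; at [al] an
    excess factor ['X - al%:P] would make only one side vanish. *)
Lemma order_at_uniq al w z z' : K al -> order_at al w z -> order_at al w z' -> z = z'.
Proof.
move=> Kal; wlog lezz' : z z' / z <= z' => [wl wz wz'|].
  have [le|/ltW le] := leP z z'; first exact: wl wz wz'.
  by apply/esym/(wl _ _ le wz' wz).
move=> [p [q [[pS qS] pa qa ->]]] [p' [q' [[p'S q'S] p'a q'a eqw]]].
have sal := sub_transcendental_neq0 Kal.
have [q0 q'0] : q.[s] != 0 /\ q'.[s] != 0.
  split; apply: transcendental_horner_neq0 => //.
    exact: neq0_horner qa.
  exact: neq0_horner q'a.
have [n zz'] : exists n : nat, z' = z + n%:Z by exists `|z' - z|%N; lia.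
suff : p * q' = ('X - al%:P) ^+ n * (p' * q).
  case: n zz' => [|n] zz'; first by rewrite zz' addr0.
  move=> /(congr1 (horner^~ al)); rewrite !hornerM horner_exp hornerXsubC subrr.
  by rewrite exprS !mul0r => /eqP; rewrite mulf_eq0 (negPf pa) (negPf q'a).
apply/eqP; rewrite -subr_eq0; apply/eqP/transcendental_horner.
  by rewrite rpredB ?rpredM ?rpredX ?polyOver_XsubS.
rewrite !hornerE; apply/eqP; rewrite subr_eq0; apply/eqP.
have zn0 : (s - al) ^ z != 0 by rewrite expfz_neq0.
apply: (mulfI zn0); move: eqw; rewrite zz' expfzDr // -!mulrA => /(mulfI zn0).
rewrite -exprnP => eqpq; congr (_ * _).
have -> : p.[s] = (s - al) ^+ n * (p'.[s] / q'.[s]) * q.[s].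
  by rewrite -eqpq divfK.
by rewrite -[LHS]mulrA (mulrC q.[s] q'.[s]) !mulrA divfK.
Qed.

Lemma order_atV al w z : order_at al w z -> order_at al w^-1 (- z).
Proof.
move=> [p [q [[pS qS] pa qa ->]]]; exists q, p; split=> //.
by rewrite invfM invf_div invr_expz.
Qed.

Lemma order_atM al w w' z z' : K al -> order_at al w z -> order_at al w' z' ->
  order_at al (w * w') (z + z').
Proof.
move=> Kal [p [q [[pS qS] pa qa ->]]] [p' [q' [[p'S q'S] p'a q'a ->]]].
exists (p * p'), (q * q'); split; rewrite ?rpredM ?hornerM ?mulf_neq0 //.
by rewrite expfzDr ?sub_transcendental_neq0 // mulrACA -mulf_div.
Qed.

Lemma order_at1 al : order_at al 1 0.
Proof. by exists 1, 1; rewrite rpred1 !hornerC oner_eq0 expr0z divr1 mulr1. Qed.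

Lemma order_at_exp al w z k : K al -> order_at al w z -> order_at al (w ^ k) (z * k).
Proof.
move=> Kal wz; have wn n : order_at al (w ^+ n) (z * n%:Z).
  elim: n => [|n IHn]; first by rewrite mulr0; exact: order_at1.
  rewrite exprS; have -> : z * n.+1%:Z = z + z * n%:Z by lia.
  exact: order_atM.
case: k => n; first exact: wn.
by rewrite NegzE mulrN -exprnN; apply: order_atV.
Qed.

Lemma order_at_phi i al w z : order_at al w z -> order_at (phi i al) (phi i w) z.
Proof.
move=> [p [q [[pS qS] pa qa ->]]]; exists (map_poly (phi i) p), (map_poly (phi i) q).
split; rewrite ?polyOver_phi //.
- by rewrite horner_phi fmorph_eq0.
- by rewrite horner_phi fmorph_eq0.
by rewrite !rmorphM /= fmorphV fmorphXz rmorphB /= phi_s !horner_phi_s.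
Qed.

Lemma order_at_sub al be : K al -> K be -> order_at al (s - be) (be == al)%:Z.
Proof.
move=> Kal Kbe; have [->|neq] := eqVneq.
  by exists 1, 1; rewrite rpred1 !hornerC oner_eq0 divr1 mulr1 expr1z.
exists ('X - be%:P), 1; rewrite rpred1 polyOver_XsubS // !hornerE oner_eq0 divr1.
by split; rewrite ?subr_eq0 1?eq_sym // expr0z mul1r.
Qed.

(** When [phi 1] is conjugation by [y], each step is a commutator with [y]. *)
Fixpoint iterated_quotient (n : nat) : F :=
  if n is n'.+1 then iterated_quotient n' / phi 1 (iterated_quotient n')
  else s - a.

(* The order of [iterated_quotient n] at [a_i] is the [n]-th difference of the
   indicator of the [i] with [a_i = a]; a bounded sequence whose [n]-th
   difference is constant is itself constant. *)
Lemma iterated_quotient_non_torsion n k : phi 1 a != a -> k != 0 ->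
  iterated_quotient n ^ k <> phi 1 (iterated_quotient n) ^ k.
Proof.
move=> a1 k0 eqk; pose e0 i := (a == orb i)%:Z.
pose e := fix e m i := if m is m'.+1 then e m' i - e m' (i - 1) else e0 i.
have shift m i : order_at (orb (i - 1)) (iterated_quotient m) (e m (i - 1)) ->
    order_at (orb i) (phi 1 (iterated_quotient m)) (e m (i - 1)).
  by move=> /(order_at_phi 1); rewrite -phiD addrC subrK.
have eP m i : order_at (orb i) (iterated_quotient m) (e m i).
  elim: m i => [|m IHm] i /=; first by apply: order_at_sub => //; exact: orbK.
  apply: order_atM; [exact: orbK|exact: IHm|apply: order_atV].
  exact/shift/IHm.
(* Equal [k]-th powers have equal orders, and the order of [phi 1 w] at one orbit point is that of
   [w] at the preceding one. *)
have /(@bounded_difference_const e n) e0C : forall i, e n i = e n (i - 1).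
  move=> i; apply: (mulIf k0).
  apply: (order_at_uniq (orbK i) (order_at_exp k (orbK i) (eP n i))).
  by rewrite eqk; apply: order_at_exp; [exact: orbK|exact/shift/eP].
have := e0C _ _ 1; rewrite subrr /= /e0 phi0 eqxx eq_sym (negPf a1).
move=> /(_ (fun _ _ => erefl)) h; suff : 0%N%:Z = 1%N%:Z by [].
by apply: h => i; case: eqP.
Qed.

Definition regular_at (al u : F) : Prop := exists p q : {poly F},
  [/\ p \is a polyOver S, q \is a polyOver S, q.[al] != 0 & u = p.[s] / q.[s]].

Lemma regular_atB al u u' : regular_at al u -> regular_at al u' ->
  regular_at al (u - u').
Proof.
move=> [p [q [pS qS qa ->]]] [p' [q' [p'S q'S q'a ->]]].
exists (p * q' - p' * q), (q * q'); split; rewrite ?rpredB ?rpredM //.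
  by rewrite hornerM mulf_neq0.
rewrite -mulNr addf_div ?transcendental_horner_neq0 //.
- by rewrite !hornerE mulNr.
- exact: neq0_horner qa.
- exact: neq0_horner q'a.
Qed.

Lemma regular_at0 al : regular_at al 0.
Proof. by exists 0, 1; rewrite rpred0 rpred1 !hornerC oner_eq0 mul0r. Qed.

Lemma regular_at_sum al (I : Type) (r : seq I) (P : pred I) (u : I -> F) :
  (forall i, P i -> regular_at al (u i)) -> regular_at al (\sum_(i <- r | P i) u i).
Proof.
move=> ur; elim/big_rec : _ => [|i x Pi rx]; first exact: regular_at0.
rewrite -[x]opprK -[- x]sub0r; apply: regular_atB; first exact: ur.
by apply: regular_atB rx; exact: regular_at0.
Qed.

Lemma regular_at_phi i al u : regular_at al u -> regular_at (phi i al) (phi i u).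
Proof.
move=> [p [q [pS qS qa ->]]]; exists (map_poly (phi i) p), (map_poly (phi i) q).
split; rewrite ?polyOver_phi //.
  by rewrite horner_phi fmorph_eq0.
by rewrite fmorph_div /= !horner_phi_s.
Qed.

Lemma phi_inj i : injective (phi i). Proof. exact: fmorph_inj. Qed.

Lemma phi_orb i j : phi i (orb j) = orb (i + j). Proof. by rewrite phiD. Qed.

Lemma orb_inj i j : (forall m : nat, (0 < m)%N -> phi m%:Z a != a) ->
  orb i = orb j -> i = j.
Proof.
move=> aper; wlog leij : i j / i <= j => [h|].
  have [le|/ltW le] := leP i j; first exact: h.
  by move=> /esym e; apply/esym/h.
have [n ->] : exists n : nat, j = i + n%:Z by exists `|j - i|%N; lia.
case: n => [|n]; first by rewrite addr0.
rewrite phiD => /phi_inj /esym /eqP.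
by rewrite (negPf (aper _ _)).
Qed.

Lemma telescope_phi u n : u - phi n%:Z u =
  \sum_(i < n) phi i%:Z (u - phi 1 u).
Proof.
elim: n => [|n IHn]; first by rewrite big_ord0 phi0 subrr.
rewrite big_ord_recr /= -IHn rmorphB /= -phiD addrA subrK.
by congr (_ - phi _ u); lia.
Qed.

Section ExactForm.
Variable u : F.
Hypothesis Lu : adjoin K [set s] u.

(** If every M > 0 had a root of the denominator [q] among its two points, then [size q] values of M
    would give too many roots, the orbit points being distinct. *)
Lemma regular_at_cofinite c : (forall m : nat, (0 < m)%N -> phi m%:Z a != a) ->
  exists M : nat, [/\ (0 < M)%N, regular_at (orb (c + M%:Z)) u
    & regular_at (orb (c - M%:Z)) u].
Proof.
move=> aper; have [p [q [pS qS q0 eu]]] := adjoin1_fraction sK Lu.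
suff [M [M0 h1 h2]] : exists M : nat, [/\ (0 < M)%N, q.[orb (c + M%:Z)] != 0
    & q.[orb (c - M%:Z)] != 0].
  by exists M; split=> //; exists p, q.
apply: contrapT => nM.
pose r M := if root q (orb (c + M%:Z)) then orb (c + M%:Z) else orb (c - M%:Z).
have rootr M : (0 < M)%N -> root q (r M).
  move=> M0; rewrite /r; case: ifPn => // nr; apply: contra_notT nM => nr'.
  by exists M.
have rinj : {in iota 1 (size q) &, injective r}.
  move=> M M'; rewrite !mem_iota => /andP[M0 _] /andP[M'0 _]; rewrite /r.
  by do 2![case: ifP => _] => /orb_inj-/(_ aper); lia.
have := max_poly_roots (neq0_horner q0) (rs := [seq r M | M <- iota 1 (size q)]).
rewrite size_map size_iota ltnn map_inj_in_uniq // iota_uniq => h.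
suff : false by []; apply: h => //; apply/allP => z /mapP[M + ->].
by rewrite mem_iota => /andP[M0 _]; exact: rootr.
Qed.

Hypothesis periodic : forall m : nat, phi m%:Z a = a -> phi m%:Z u = u.

(* In [u - phi^N u = sum_(i < N) phi^i b], at a suitable point of the orbit only
   one summand can be singular, whereas the left-hand side is regular there. *)
Lemma exact_pole c b : b = u - phi 1 u ->
    (forall i, orb i != orb c -> regular_at (orb i) b) ->
  regular_at (orb c) b.
Proof.
move=> eb breg; suff [N [i0 [ltiN reg neq]]] : exists N i0 : nat,
    [/\ (i0 < N)%N, regular_at (orb (c + i0%:Z)) (u - phi N%:Z u)
      & forall i : nat, (i < N)%N -> i != i0 -> orb (c + i%:Z) != orb (c + i0%:Z)].
  suff : regular_at (orb (c + i0%:Z)) (phi i0%:Z b).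
    move=> /(@regular_at_phi (- i0%:Z)); rewrite phi_orb.
    by rewrite -[phi (- _) (phi _ b)]phiD addNr phi0 addrC addrK.
  move: reg; rewrite telescope_phi -eb (bigD1 (Ordinal ltiN)) //= => reg.
  set rest := \sum_(_ < _ | _) _ in reg.
  rewrite -[phi _ b](addrK rest); apply: regular_atB reg _.
  apply: regular_at_sum => i; rewrite -val_eqE /= => neqi.
  have -> : orb (c + i0%:Z) = phi i%:Z (orb (c + i0%:Z - i%:Z)).
    by rewrite phi_orb [i%:Z + _]addrC subrK.
  apply: regular_at_phi; apply: breg; apply: contra_neq (neq i _ neqi) => // e.
  by have := congr1 (phi i%:Z) e; rewrite !phi_orb ![i%:Z + _]addrC subrK => ->.
have [[m m0 am]|aper] := pselect (exists2 m : nat, (0 < m)%N & phi m%:Z a == a).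
  have exm : exists k : nat, (0 < k)%N && (phi k%:Z a == a).
    by exists m; rewrite m0.
  case: (ex_minnP exm) => N /andP[N0 /eqP aN] Nmin.
  (* Periodic orbit: [N] is the least period, so the left-hand side is 0. *)
  exists N, 0%N; split=> //; first by rewrite periodic // subrr; exact: regular_at0.
  move=> i ltiN i0; rewrite addr0 phiD; apply: contraTneq ltiN => /phi_inj/eqP ai.
  by rewrite -leqNgt Nmin // lt0n i0.
have {}aper m : (0 < m)%N -> phi m%:Z a != a.
  by move=> m0; apply: contra_notN aper => am; exists m.
have [M [M0 regM regM']] := regular_at_cofinite c aper.
(* Infinite orbit: at index c + M, [u] is regular, and so is its shift by 2M because [u] is regular
   at index c - M. *)
exists (M + M)%N, M; split; first by lia.
  apply: regular_atB => //; have -> : c + M%:Z = (M + M)%N%:Z + (c - M%:Z) by lia.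
  by rewrite -phi_orb; exact: regular_at_phi.
by move=> i _ neqi; apply: contra_neqN neqi => /eqP/(orb_inj aper); lia.
Qed.

Lemma not_regular_at_pole al be g n : K al -> K be -> K g -> al != be -> g != 0 ->
  ~ regular_at be (g * ((s - al) / (s - be)) ^+ n.+1).
Proof.
move=> Kal Kbe Kg neq g0 [p [q [pS qS qb eqb]]].
have sbe := sub_transcendental_neq0 Kbe.
have q0 : q.[s] != 0 by apply: transcendental_horner_neq0; last exact: neq0_horner qb.
have : g%:P * ('X - al%:P) ^+ n.+1 * q = ('X - be%:P) ^+ n.+1 * p.
  apply/eqP; rewrite -subr_eq0; apply/eqP/transcendental_horner.
    by rewrite rpredB ?rpredM ?rpredX ?polyOver_XsubS ?polyOverC //; apply/subfieldP.
  rewrite !hornerE; apply/eqP; rewrite subr_eq0; apply/eqP.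
  have -> : p.[s] = g * ((s - al) / (s - be)) ^+ n.+1 * q.[s] by rewrite eqb divfK.
  rewrite expr_div_n [RHS]mulrA; congr (_ * _).
  by rewrite [in RHS]mulrC mulrA divfK ?expf_neq0.
move=> /(congr1 (horner^~ be)); rewrite !hornerE subrr [0 ^+ _]exprS mul0r mul0r.
move/eqP; rewrite !mulf_eq0 expf_eq0 subr_eq0 [be == _]eq_sym.
by rewrite (negPf neq) (negPf g0) (negPf qb).
Qed.

Lemma regular_at_quotient al be ga g n : K al -> K be -> K ga -> K g -> al != ga ->
  regular_at ga (g * ((s - be) / (s - al)) ^+ n).
Proof.
move=> Kal Kbe Kga Kg neq.
exists (g%:P * ('X - be%:P) ^+ n), (('X - al%:P) ^+ n).
rewrite rpredM ?rpredX ?polyOver_XsubS ?polyOverC //; last exact/subfieldP.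
rewrite !hornerE expr_div_n mulrA; split=> //.
by rewrite expf_neq0 // subr_eq0 eq_sym.
Qed.

(** The only pole is [phi 1 a] for positive [l] and [a] for negative [l]; [exact_pole] would remove
    it. *)
Lemma quotient_not_exact g (l : int) : K g -> g != 0 -> l != 0 -> phi 1 a != a ->
  g * ((s - a) / (s - phi 1 a)) ^ l <> u - phi 1 u.
Proof.
move=> Kg g0 l0 a1 eqb; have Ka1 := orbK 1; have Ka0 := orbK 0; rewrite phi0 in Ka0.
have [n [el|el]] : exists n : nat, l = n.+1%:Z \/ l = - n.+1%:Z.
  by exists `|l|.-1; lia.
- have := @exact_pole 1 _ eqb; rewrite el -exprnP => h.
  apply: (@not_regular_at_pole a (phi 1 a) g n) => //; first by rewrite eq_sym.
  apply: h => i neq; apply: regular_at_quotient => //; first exact: orbK.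
  by rewrite eq_sym.
- have e : ((s - a) / (s - phi 1 a)) ^ l = ((s - phi 1 a) / (s - a)) ^+ n.+1.
    by rewrite el -exprnN -exprVn invf_div.
  have := @exact_pole 0 _ eqb; rewrite e phi0 => h.
  apply: (@not_regular_at_pole (phi 1 a) a g n) => //.
  apply: h => i neq; apply: regular_at_quotient => //; first exact: orbK.
  by rewrite eq_sym.
Qed.

End ExactForm.
End ShiftedRationalFunctions.

(** * Iterated sums in skew polynomial rings *)

Section SummationOperators.
Variables (D : divisionRingType) (L : divringClosed D) (Y : D).

Local Notation tau u := (Y * u * Y^-1).
Local Notation Delta := (1 - Y).

Hypothesis tauL : forall u, u \in L -> tau u \in L.
Hypothesis Y_free : forall n (l : nat -> D), (forall i, l i \in L) ->
  \sum_(i < n) l i * Y ^+ i = 0 -> forall i : 'I_n, l i = 0.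

Definition exact_form (b : D) : Prop := exists2 u, u \in L & b = u - tau u.

(** A left module over the skew polynomials in [Y] with coefficients in [L]; computing modulo [T]
    will mean neglecting shorter words. *)
Definition skew_module (T : set D) : Prop :=
  [/\ T 0, forall x z, T x -> T z -> T (x + z),
      forall u x, u \in L -> T x -> T (u * x)
    & forall x, T x -> T (Y * x)].

Lemma Y_unit : Y \is a GRing.unit.
Proof.
apply/nonzero_unit/eqP => Y0.
pose l i : D := if i == 1%N then 1 else 0.
have lL i : l i \in L by rewrite /l; case: ifP; rewrite ?rpred0 ?rpred1.
have := Y_free (n := 2) lL; rewrite !big_ord_recr big_ord0 /= /l /= expr1.
rewrite Y0 mulr0 mul0r !addr0 => /(_ erefl (@Ordinal 2 1 erefl))/eqP.
by rewrite /= oner_eq0.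
Qed.

Lemma Delta_unit : Delta \is a GRing.unit.
Proof.
apply/nonzero_unit/eqP => D0.
pose l i : D := if i == 0%N then 1 else -1.
have lL i : l i \in L by rewrite /l; case: ifP; rewrite ?rpredN ?rpred1.
have := Y_free (n := 2) lL; rewrite !big_ord_recr big_ord0 /= /l /= expr1.
rewrite add0r mul1r expr0 mulN1r D0 => /(_ erefl ord0)/eqP.
by rewrite oner_eq0.
Qed.

Lemma mulYM (u x : D) : Y * (u * x) = tau u * (Y * x).
Proof. by rewrite !mulrA mulrVK ?Y_unit. Qed.

Section Modulo.
Variable T : set D.
Hypothesis Tmod : skew_module T.

Let T0 : T 0. Proof. by case: Tmod. Qed.
Let TD x z : T x -> T z -> T (x + z).
Proof. by case: Tmod => _ TD _ _; exact: TD. Qed.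
Let TM u x : u \in L -> T x -> T (u * x).
Proof. by case: Tmod => _ _ TM _; exact: TM. Qed.
Let TY x : T x -> T (Y * x). Proof. by case: Tmod => _ _ _; exact. Qed.

Lemma skew_moduleN x : T x -> T (- x).
Proof. by move=> Tx; rewrite -mulN1r; apply: TM; rewrite // rpredN rpred1. Qed.
Lemma skew_moduleB x z : T x -> T z -> T (x - z).
Proof. by move=> Tx /skew_moduleN; apply: TD. Qed.
Lemma skew_module_sum n (F : 'I_n -> D) : (forall i, T (F i)) -> T (\sum_i F i).
Proof. by move=> TF; elim/big_ind : _. Qed.

Lemma skew_module_Delta x : T x -> T (Delta * x).
Proof. by move=> Tx; rewrite mulrBl mul1r; apply: skew_moduleB; last apply: TY. Qed.

Lemma skew_module_subr x z : T (x - z) -> T x -> T z.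
Proof. by move=> Txz Tx; rewrite -[z](subKr x); apply: skew_moduleB. Qed.

(** Twisted Leibniz rule: [Delta * (u * z)] is [(u - tau u) * z + tau u * (Delta * z)], and the last
    term lies in [T]. *)
Lemma Delta_mul (u z : D) : u \in L -> T (Delta * z) ->
  T (Delta * (u * z) - (u - tau u) * z).
Proof.
move=> uL Tz; have -> : Delta * (u * z) - (u - tau u) * z = tau u * (Delta * z).
  rewrite !mulrBl !mul1r mulrBr mulYM opprB [LHS]addrC addrA subrK.
  by [].
by apply: TM => //; exact: tauL.
Qed.

(* As in Artin's lemma, applying [Delta] to the relation either shows that a
   coefficient is fixed by [tau] or expresses the corresponding [v i] in terms of
   the others. *)
Lemma constants_combination n (lam : nat -> D) (v : nat -> D) z :
    (forall i, lam i \in L) -> (forall i, T (Delta * v i)) -> T (Delta * z) ->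
    T (z - \sum_(i < n) lam i * v i) ->
  exists gam : nat -> D, [/\ forall i, gam i \in L, forall i, tau (gam i) = gam i
    & T (z - \sum_(i < n) gam i * v i)].
Proof.
move=> + Tv; elim: n => [|n IHn] in lam z *.
  move=> lamL Tz; rewrite big_ord0 => Tz0; exists (fun=> 0); split.
  - by move=> _; rewrite rpred0.
  - by move=> _; rewrite mulr0 mul0r.
  - by rewrite big_ord0.
move=> lamL Tz Tsum1; have Tsum := Tsum1; rewrite big_ord_recr /= in Tsum.
have [fixn|movn] := eqVneq (lam n - tau (lam n)) 0.
  have Tzn : T (Delta * (z - lam n * v n)).
    rewrite mulrBr; apply: skew_moduleB => //.
    by have := Delta_mul (lamL n) (Tv n); rewrite fixn mul0r subr0.
  have [|gam [gamL gamF Tgam]] := IHn lam _ lamL Tzn.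
    by rewrite -addrA -opprD [lam n * _ + _]addrC.
  exists (fun i => if i == n then lam n else gam i); split => [i|i|].
  - by case: eqP.
  - by case: eqP => // _; apply/esym/eqP; rewrite -subr_eq0 fixn.
  rewrite big_ord_recr /= eqxx opprD addrA addrAC.
  rewrite (eq_bigr (fun i : 'I_n => gam i * v i)) // => i _.
  by rewrite ltn_eqF.
(* Applying [Delta] removes [z] modulo [T] and leaves a relation with coefficients [d i]; as [d n]
   is invertible it can be solved for [v n]. *)
pose d i := lam i - tau (lam i).
have dL i : d i \in L by rewrite rpredB ?tauL.
have Td : T (\sum_(i < n.+1) d i * v i).
  have TDz : T (Delta * z - \sum_(i < n.+1) d i * v i).
    have := skew_module_Delta Tsum1; rewrite mulrBr.
    have : T (\sum_(i < n.+1) (Delta * (lam i * v i) - d i * v i)).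
      by apply: skew_module_sum => i; apply: Delta_mul.
    rewrite sumrB -mulr_sumr => T1 T2; have := TD T2 T1.
    by rewrite addrA subrK.
  exact: skew_module_subr TDz Tz.
pose mu i := - ((d n)^-1 * d i).
have muL i : mu i \in L by rewrite rpredN rpredM ?rpredV.
have Tvn : T (v n - \sum_(i < n) mu i * v i).
  have := TM _ Td; move=> /(_ (d n)^-1); rewrite rpredV dL => /(_ isT).
  rewrite big_ord_recr /= mulrDr mulrA mulVr ?mul1r; last exact: nonzero_unit.
  rewrite addrC mulr_sumr; congr T; congr (_ + _).
  by rewrite -sumrN; apply: eq_bigr => i _; rewrite mulNr opprK mulrA.
have [i||gam [gamL gamF Tgam]] := IHn (fun i => lam i + lam n * mu i) z _ Tz.
- by rewrite rpredD ?rpredM.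
- have := TD Tsum (TM (lamL n) Tvn); congr T.
  under [in RHS]eq_bigr do rewrite mulrDl -mulrA.
  rewrite big_split /= -mulr_sumr mulrBr !opprD !addrA; congr (_ - _).
  by rewrite subrK.
exists (fun i => if i == n then 0 else gam i); split => [i|i|].
- by case: eqP; rewrite ?rpred0.
- by case: eqP; rewrite ?mulr0 ?mul0r.
rewrite big_ord_recr /= eqxx mul0r addr0.
rewrite (eq_bigr (fun i : 'I_n => gam i * v i)) // => i _.
by rewrite ltn_eqF.
Qed.

Lemma exact_formD b b' : exact_form b -> exact_form b' -> exact_form (b + b').
Proof.
move=> [u uL ->] [u' u'L ->]; exists (u + u'); first by rewrite rpredD.
by rewrite mulrDr mulrDl opprD addrACA.
Qed.

(** Induction on the number of terms: modulo [T], [z n] is a combination of [zeta] and the other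
    [z i] with coefficients fixed by [tau]. Substituting it keeps every coefficient of the form
    [u - tau u] and changes [b] by an exact form. With no term left [b] must be 0, since [zeta] is
    not in [T]. *)
Lemma exact_of_combination n (u z : nat -> D) b zeta :
    (forall i, u i \in L) -> (forall i, T (Delta * z i)) ->
    T (Delta * zeta) -> ~ T zeta -> b \in L ->
    T (b * zeta - \sum_(i < n) (u i - tau (u i)) * z i) ->
  exact_form b.
Proof.
move=> + Tz Tzeta NTzeta; elim: n => [|n IHn] in u b *.
  move=> uL bL; rewrite big_ord0 subr0 => Tb.
  have [->|b0] := eqVneq b 0.
    by exists 0; rewrite ?rpred0 // mulr0 mul0r subr0.
  case: NTzeta; have := TM _ Tb => /(_ b^-1); rewrite rpredV bL => /(_ isT).
  by rewrite mulKr //; exact: nonzero_unit.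
move=> uL bL; pose d i := u i - tau (u i).
have dL i : d i \in L by rewrite rpredB ?tauL.
rewrite big_ord_recr /= -/(d n) => Tb.
have [dn0|dn0] := eqVneq (d n) 0.
  by apply: (IHn u) => //; rewrite dn0 mul0r addr0 in Tb.
(* The relation is solved for [z n], and [zeta] takes the free index n. *)
pose v i := if i == n then zeta else z i.
pose lam i := if i == n then (d n)^-1 * b else - ((d n)^-1 * d i).
have lamL i : lam i \in L.
  by rewrite /lam; case: eqP => _; rewrite ?rpredN rpredM ?rpredV.
have Tv i : T (Delta * v i) by rewrite /v; case: eqP.
have [|gam [gamL gamF]] := constants_combination (n := n.+1) lamL Tv (Tz n).
  have := TM (u := - (d n)^-1) _ Tb; rewrite rpredN rpredV dL => /(_ isT).
  rewrite big_ord_recr /= /lam /v eqxx; congr T.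
  rewrite [in RHS](eq_bigr (fun i : 'I_n => - ((d n)^-1 * d i * z i))); last first.
    by move=> i _; rewrite !ltn_eqF ?mulNr.
  rewrite sumrN mulNr mulrBr mulrDr mulKr; last exact: nonzero_unit.
  rewrite opprB [_ + z n]addrC opprD opprK addrA mulrA; congr (_ + _ - _).
  by rewrite mulr_sumr; apply: eq_bigr => i _; rewrite mulrA.
rewrite big_ord_recr /= /v eqxx => Tgam.
rewrite (eq_bigr (fun i : 'I_n => gam i * z i)) in Tgam; last first.
  by move=> i _; rewrite ltn_eqF.
have tauM w g : tau g = g -> tau (w * g) = tau w * g.
  by move=> gF; rewrite -{2}gF !mulrA mulrVK ?Y_unit.
pose w i := u i + u n * gam i.
have exn : exact_form (u n * gam n - tau (u n * gam n)).
  by exists (u n * gam n) => //; rewrite rpredM.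
suff exb : exact_form (b - (u n * gam n - tau (u n * gam n))).
  by have := exact_formD exb exn; rewrite subrK.
apply: (IHn w).
- by move=> i; rewrite rpredD ?rpredM.
- by rewrite rpredB // rpredB ?tauL ?rpredM.
have := TD Tb (TM (dL n) Tgam); congr T.
rewrite [in RHS](eq_bigr (fun i : 'I_n => d i * z i + d n * (gam i * z i))).
  rewrite big_split /= -mulr_sumr tauM // -mulrBl -/(d n).
  have -> : \sum_(i < n) (u i - tau (u i)) * z i = \sum_(i < n) d i * z i by [].
  move: (\sum_(i < n) d i * z i) (\sum_(i < n) gam i * z i) (d n) => B G e.
  rewrite mulrBl mulrBr mulrDr !opprD !mulrA !addrA.
  rewrite subrK addrAC; congr (_ - _); exact: addrAC.
move=> i _; rewrite /w mulrDr mulrDl tauM // opprD addrACA mulrDl -mulrBl.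
by rewrite -/(d i) -/(d n) -mulrA.
Qed.

End Modulo.

Definition skew_poly : set D := [set x | exists n (l : nat -> D),
  (forall i, l i \in L) /\ x = \sum_(i < n) l i * Y ^+ i].

(* Sums of words [u_0 Delta^-1 u_1 Delta^-1 ... u_r P] with at most [r] letters
   [Delta^-1], where the [u_i] lie in [L] and [P] is a polynomial in [Y]. *)
Fixpoint iterated_sums (r : nat) : set D :=
  if r is r'.+1 then
    [set x | exists n (u z : nat -> D), [/\ forall i, u i \in L,
       forall i, iterated_sums r' (Delta * z i)
       & x = \sum_(i < n) u i * z i]]
  else skew_poly.

Lemma skew_poly_mod : skew_module skew_poly.
Proof.
split.
- by exists 0%N, (fun=> 0); rewrite big_ord0; split=> // i; rewrite rpred0.
- move=> x z [n [l [lL ->]]] [m [k [kL ->]]].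
  pose ext p (f : nat -> D) i := if (i < p)%N then f i else 0.
  have extE p q (f : nat -> D) : (p <= q)%N ->
      \sum_(i < p) f i * Y ^+ i = \sum_(i < q) ext p f i * Y ^+ i.
    move=> lepq; rewrite (big_ord_widen q (fun i => f i * Y ^+ i)) //.
    rewrite big_mkcond /=; apply: eq_bigr => i _; rewrite /ext.
    by case: ifP => //; rewrite mul0r.
  exists (maxn n m), (fun i => ext n l i + ext m k i); split=> [i|].
    by rewrite rpredD // /ext; case: ifP => // _; rewrite rpred0.
  rewrite (extE n (maxn n m)) ?leq_maxl // (extE m (maxn n m)) ?leq_maxr //.
  by rewrite -big_split /=; apply: eq_bigr => i _; rewrite mulrDl.
- move=> u x uL [n [l [lL ->]]]; exists n, (fun i => u * l i).
  split=> [i|]; first by rewrite rpredM.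
  by rewrite mulr_sumr; apply: eq_bigr => i _; rewrite mulrA.
move=> x [n [l [lL ->]]].
exists n.+1, (fun i => if i is i'.+1 then tau (l i') else 0); split.
  by case=> [|i]; rewrite ?rpred0 ?tauL.
rewrite big_ord_recl mul0r add0r mulr_sumr; apply: eq_bigr => i _.
by rewrite mulYM -exprS.
Qed.

Lemma iterated_sums_mod r : skew_module (iterated_sums r).
Proof.
elim: r => [|r IHr]; first exact: skew_poly_mod.
have [T0 TD TM TY] := IHr; split.
- exists 0%N, (fun=> 0), (fun=> 0); rewrite big_ord0.
  by split=> // i; rewrite ?rpred0 ?mulr0.
- move=> x x' [n [u [z [uL Tz ->]]]] [m [u' [z' [u'L Tz' ->]]]].
  pose cat (f g : nat -> D) i := if (i < n)%N then f i else g (i - n)%N.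
  exists (n + m)%N, (cat u u'), (cat z z'); split.
  + by move=> i; rewrite /cat; case: ifP.
  + by move=> i; rewrite /cat; case: ifP => _; [exact: Tz|exact: Tz'].
  rewrite big_split_ord /=; congr (_ + _); apply: eq_bigr => i _.
    by rewrite /cat /= ltn_ord.
  by rewrite /cat /= ltnNge leq_addr /= addKn.
- move=> u x uL [n [l [z [lL Tz ->]]]]; exists n, (fun i => u * l i), z.
  split=> // [i|]; first by rewrite rpredM.
  by rewrite mulr_sumr; apply: eq_bigr => i _; rewrite mulrA.
move=> x [n [u [z [uL Tz ->]]]].
exists n, (fun i => tau (u i)), (fun i => Y * z i); split.
- by move=> i; apply: tauL.
- move=> i; have -> : Delta * (Y * z i) = Y * (Delta * z i).
    by rewrite !mulrBl !mul1r mulrBr.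
  exact: (TY _ (Tz i)).
by rewrite mulr_sumr; apply: eq_bigr => i _; rewrite mulYM.
Qed.

Lemma iterated_sumsS_Delta r z : iterated_sums r (Delta * z) ->
  iterated_sums r.+1 z.
Proof.
move=> Tz; exists 1%N, (fun=> 1), (fun=> z); split=> // [i|].
  by rewrite rpred1.
by rewrite big_ord1 mul1r.
Qed.

Lemma iterated_sumsS r z : iterated_sums r z -> iterated_sums r.+1 z.
Proof.
move=> Tz; apply: iterated_sumsS_Delta.
exact: skew_module_Delta (iterated_sums_mod r) _ Tz.
Qed.

Lemma iterated_sums_const r u : u \in L -> iterated_sums r u.
Proof.
elim: r => [|r IHr] uL; last exact/iterated_sumsS/IHr.
exists 1%N, (fun i => if i == 0%N then u else 0); split=> [i|].
  by case: eqP; rewrite ?rpred0.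
by rewrite big_ord1 /= expr0 mulr1.
Qed.

(** The top coefficient of [x] reappears, twisted by [tau], one degree higher in [Y * x], where
    nothing cancels it. *)
Lemma Delta_skew_poly_const b x : b \in L -> skew_poly x -> Delta * x = b ->
  b = 0.
Proof.
move=> bL [n [l [lL ->]]].
elim: n => [|n IHn].
  by rewrite big_ord0 mulr0.
move=> eqb; suff ln0 : l n = 0.
  by apply: IHn; move: eqb; rewrite big_ord_recr /= ln0 mul0r addr0.
(* The coefficients of [b + Y * x - x], which is 0. *)
pose k i :=
  (if i is i'.+1 then tau (l i') else b) - (if (i <= n)%N then l i else 0).
have kL i : k i \in L.
  rewrite rpredB //; first by case: i => // i; apply: tauL.
  by case: ifP; rewrite ?rpred0.
have := Y_free (n := n.+2) kL _ ord_max; rewrite /k /= ltnn subr0.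
have -> : \sum_(i < n.+2) k i * Y ^+ i = 0.
  under eq_bigr do rewrite mulrBl.
  rewrite sumrB big_ord_recl expr0 mulr1.
  rewrite [X in _ - X]big_ord_recr /= ltnn mul0r addr0.
  rewrite [X in _ - X](eq_bigr (fun i : 'I_n.+1 => l i * Y ^+ i)); last first.
    by move=> i _; rewrite -ltnS ltn_ord.
  apply/eqP; rewrite subr_eq0; apply/eqP; rewrite -eqb mulrBl mul1r.
  rewrite [X in _ - X]mulr_sumr.
  rewrite [X in _ - X](eq_bigr (fun i : 'I_n.+1 => tau (l i) * Y ^+ i.+1)).
    by rewrite subrK.
  by move=> i _; rewrite mulYM -exprS.
move=> /(_ erefl) ln; have /(congr1 (fun z => Y^-1 * z * Y)) := ln.
rewrite mulr0 mul0r => <-.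
by rewrite !mulrA mulVr ?Y_unit // mul1r mulrVK ?Y_unit.
Qed.

(* The product is [Delta^-1 b_1 ... Delta^-1 b_r] up to words with fewer letters
   [Delta^-1]; since no [b_i] is exact it cannot be shortened. *)
Theorem iterated_sums_neq1 (w : seq (D * D)) :
    w != [::] ->
    (forall p, p \in w -> [/\ p.1 \in L, p.2 \in L & ~ exact_form p.2]) ->
  \prod_(p <- w) (p.1 + Delta^-1 * p.2) <> 1.
Proof.
pose prodw w := \prod_(p <- w : seq (D * D)) (p.1 + Delta^-1 * p.2).
move=> w0 wP eqw; have [r sw] : exists r, size w = r.+1.
  by case: (w) w0 => // p w'; exists (size w').
(* A product of r + 1 factors is compared with sums of words having at most r letters [Delta^-1],
   among which is 1. The decomposition into [zeta] and [tail] serves the induction. *)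
suff [nTw _] : ~ iterated_sums r (prodw w) /\ exists zeta tail,
    [/\ prodw w = zeta + tail, iterated_sums r (Delta * zeta)
      & iterated_sums r tail].
  by apply: nTw; rewrite /prodw eqw; apply: iterated_sums_const; rewrite rpred1.
elim: r w sw wP {w0 eqw} => [|r IHr] [|[c b] w] //= [sw] wP.
  have [/= cL bL nexb] := wP _ (mem_head _ _).
  have -> : w = [::] by case: w sw {wP}.
  rewrite /prodw big_seq1 /=; have [T0 TD TM TY] := skew_poly_mod.
  have Tc : skew_poly c by apply: (@iterated_sums_const 0).
  split; last first.
    exists (Delta^-1 * b), c; rewrite addrC mulrA divrr ?Delta_unit // mul1r.
    by split=> //; apply: (@iterated_sums_const 0).
  (* If [Delta^-1 * b] were a skew polynomial, [b] would be 0, which is exact. *)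
  move=> Tw; apply: nexb; exists 0; rewrite ?rpred0 // mulr0 mul0r subr0.
  apply: (@Delta_skew_poly_const _ (Delta^-1 * b) bL).
    by have := skew_moduleB skew_poly_mod Tw Tc; rewrite addrAC subrr add0r.
  by rewrite mulrA divrr ?Delta_unit // mul1r.
have [/= cL bL nexb] := wP _ (mem_head _ _).
have [|nT [zeta [tail [ew Tzeta Ttail]]]] := IHr w sw.
  by move=> p pw; apply: wP; rewrite in_cons pw orbT.
have -> : prodw ((c, b) :: w) = c * prodw w + Delta^-1 * (b * prodw w).
  by rewrite /prodw big_cons /= mulrDl mulrA.
have [T0 TD TM TY] := iterated_sums_mod r.+1.
have Tw : iterated_sums r.+1 (prodw w).
  by rewrite ew; apply: TD; [exact: iterated_sumsS_Delta|exact: iterated_sumsS].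
have Tc : iterated_sums r.+1 (c * prodw w) by apply: TM.
have DV x : Delta * (Delta^-1 * x) = x by rewrite mulrA divrr ?Delta_unit ?mul1r.
split; last first.
  exists (Delta^-1 * (b * prodw w)), (c * prodw w).
  by rewrite addrC DV; split=> //; apply: TM.
move=> /(skew_moduleB (iterated_sums_mod r.+1))/(_ Tc).
rewrite addrC addKr => -[n [u [z [uL Tz eqb]]]].
have [T0' TD' TM' TY'] := iterated_sums_mod r.
apply: nexb; apply: (exact_of_combination (iterated_sums_mod r) (n := n)
  (u := u) (z := z) (zeta := zeta)) => //.
  by move=> Tz'; apply: nT; rewrite ew; apply: TD'.
(* Applying [Delta] to the supposed expression of [Delta^-1 * (b * prodw w)] writes [b * zeta] with
   coefficients [u i - tau (u i)], modulo shorter words. *)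
have Tsum : iterated_sums r (\sum_(i < n)
    (Delta * (u i * z i) - (u i - tau (u i)) * z i)).
  apply: (skew_module_sum (iterated_sums_mod r)) => i.
  exact: (Delta_mul (iterated_sums_mod r) (uL i) (Tz i)).
have := skew_moduleB (iterated_sums_mod r) Tsum (TM' _ _ bL Ttail).
by rewrite sumrB -mulr_sumr -eqb DV ew mulrDr (addrAC _ _ (- (b * tail))) addrK.
Qed.

End SummationOperators.

(** * Free pairs and free groups *)

Section FreePairs.
Variable D : divisionRingType.
Implicit Types (u v g : D) (k : int).

Definition nonzero_pairs (s : seq (int * int)) : bool :=
  all (fun p => (p.1 != 0) && (p.2 != 0)) s.

(* It is enough to test the words which start with a power of [u] and end with
   a power of [v]. *)
Definition free_pair u v : Prop :=
  forall s, s != [::] -> nonzero_pairs s ->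
  \prod_(p <- s) (u ^ p.1 * v ^ p.2) <> 1.

(** General alternating words: [b] tells whether the first syllable is a power of [u], and the
    length may be odd. *)
Fixpoint syllables u v (b : bool) (s : seq int) : D :=
  if s is k :: s' then (if b then u else v) ^ k * syllables u v (~~ b) s' else 1.

Lemma conj_exprz g u k : g \is a GRing.unit -> u \is a GRing.unit ->
  (g^-1 * u * g) ^ k = g^-1 * u ^ k * g.
Proof.
move=> Ug Uu; have conjX n : (g^-1 * u * g) ^+ n = g^-1 * u ^+ n * g.
  elim: n => [|n IHn]; first by rewrite !expr0 mulr1 mulVr.
  by rewrite !exprS IHn !mulrA mulrK.
case: k => n; rewrite /exprz /= conjX //.
by rewrite invrM ?invrM ?unitrMl ?unitrV ?unitrX // invrK mulrA.
Qed.

Lemma free_pair_conj g u v : g != 0 -> u != 0 -> v != 0 -> free_pair u v ->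
  free_pair (g^-1 * u * g) (g^-1 * v * g).
Proof.
move=> /nonzero_unit Ug /nonzero_unit Uu /nonzero_unit Uv uv_free s s0 sP.
have -> : \prod_(p <- s) ((g^-1 * u * g) ^ p.1 * (g^-1 * v * g) ^ p.2) =
    g^-1 * (\prod_(p <- s) (u ^ p.1 * v ^ p.2)) * g.
  elim: s {s0 sP} => [|p s IHs]; first by rewrite !big_nil mulr1 mulVr.
  by rewrite !big_cons IHs !conj_exprz // !mulrA !mulrK.
move=> eq1; apply: (uv_free s s0 sP).
have UVg : g^-1 \is a GRing.unit by rewrite unitrV.
by apply: (mulrI UVg); apply: (mulIr Ug); rewrite eq1 mulr1 mulVr.
Qed.

Lemma syllables_cat u v b s1 s2 : syllables u v b (s1 ++ s2) =
  syllables u v b s1 * syllables u v (odd (size s1) (+) b) s2.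
Proof.
elim: s1 b => [|k s1 IHs] b /=; first by rewrite mul1r.
by rewrite IHs mulrA addNb addbN.
Qed.

Lemma free_pair_even u v s : free_pair u v -> all (predC1 0) s -> s != [::] ->
  ~~ odd (size s) -> syllables u v true s <> 1.
Proof.
move=> uv_free s0 sN odds;
have [ps [psn pss ->]] : exists ps,
    [/\ nonzero_pairs ps, (ps == [::]) = (s == [::])
      & syllables u v true s = \prod_(p <- ps) (u ^ p.1 * v ^ p.2)].
  elim: {sN}(size s) {-2}s (leqnn (size s)) s0 odds => [|n IHn] [|k [|l s']] //=.
  - by exists [::]; rewrite big_nil.
  - by exists [::]; rewrite big_nil.
  rewrite negbK => les /and3P[k0 l0 s'0] odds'.
  have [|ps [psn _ eqps]] := IHn s' _ s'0 odds'; first exact: ltnW.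
  exists ((k, l) :: ps); split=> //=; first by rewrite k0 l0.
  by rewrite big_cons eqps mulrA.
by apply: uv_free; rewrite ?pss.
Qed.

(** An odd word equal to 1 is repeated, with powers 1 and -1 of the other letter inserted; an even
    word starting with [v] is conjugated by its first syllable. Both give an even word starting with
    [u]. *)
Lemma free_pair_syllables u v b s : u != 0 -> v != 0 -> free_pair u v ->
  all (predC1 0) s -> s != [::] -> syllables u v b s <> 1.
Proof.
move=> /nonzero_unit Uu /nonzero_unit Uv uv_free s0 sN eq1.
have uvE := free_pair_even uv_free.
have [odds|evens] := boolP (odd (size s)); case: b eq1 => eq1.
- apply: (uvE (s ++ [:: 1] ++ s ++ [:: -1])).
  + by rewrite !all_cat s0.
  + by case: (s).
  + by rewrite !size_cat /= !oddD /= odds.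
  by rewrite !syllables_cat /= !odds /= eq1 !mul1r !mulr1 expr1z exprN1 mulrV.
- apply: (uvE ([:: 1] ++ s ++ [:: -1] ++ s)).
  + by rewrite !all_cat s0.
  + by [].
  + by rewrite !size_cat /= !oddD /= odds.
  by rewrite !syllables_cat /= !odds /= eq1 !mulr1 mul1r expr1z exprN1 mulrV.
- exact: uvE eq1.
case: s s0 sN eq1 evens => //= k s /andP[k0 s0] _ eq1; rewrite negbK => odds.
apply: (uvE (s ++ [:: k])).
- by rewrite all_cat s0 /= k0.
- by case: (s).
- by rewrite size_cat /= addn1 /= odds.
rewrite syllables_cat /= odds /= mulr1.
have Uk : v ^ k \is a GRing.unit by rewrite unitrXz.
by apply: (mulrI Uk); rewrite mulrA eq1 mul1r mulr1.
Qed.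

(** A factor [u ^ k * (v^-1 * u * v) ^ l] spells [u ^ k * v^-1 * u ^ l * v], so products of such
    factors remain alternating. *)
Lemma free_pair_conjr u v : u != 0 -> v != 0 -> free_pair u v ->
  free_pair u (v^-1 * u * v).
Proof.
move=> u0 v0 uv_free s sN sP.
have Uu := nonzero_unit u u0; have Uv := nonzero_unit v v0.
pose t := flatten [seq [:: p.1; -1; p.2; 1] | p <- s].
have -> : \prod_(p <- s) (u ^ p.1 * (v^-1 * u * v) ^ p.2) = syllables u v true t.
  rewrite /t; elim: s {sN sP t} => [|p s IHs]; first by rewrite big_nil.
  by rewrite big_cons IHs /= conj_exprz // expr1z exprN1 !mulrA.
apply: free_pair_syllables => //.
  rewrite /t; elim: s {sN t} sP => //= p s IHs /andP[/andP[p1 p2] sP].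
  by rewrite p1 p2 IHs.
by rewrite /t; case: (s) sN.
Qed.

End FreePairs.

Section Generation.
Variable G : groupType.

Lemma generated_subgroup (A : set G) : is_subgroup (generated A).
Proof.
split.
- by move=> H [[]].
- move=> x z Ax Az H [sH AH]; have [_ HM _] := sH.
  by apply: HM; [exact: Ax|exact: Az].
move=> x Ax H [sH AH]; have [_ _ HV] := sH.
by apply: HV; exact: Ax.
Qed.

Lemma sub_generated (A : set G) : (A `<=` generated A)%classic.
Proof. by move=> x Ax H [_ AH]; apply: AH. Qed.

Lemma generated_min (A H : set G) :
  is_subgroup H -> (A `<=` H)%classic -> (generated A `<=` H)%classic.
Proof. by move=> sH AH x; apply. Qed.

End Generation.

Section FreeGroup.
Variable D : divisionRingType.
Implicit Types x y : nonzero D.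

Let lsign (b : bool) : int := if b then -1 else 1.

(** Runs of one letter merge into a syllable. The sign of the first exponent is recorded because
    reducedness gives an equal new letter the same sign, so that exponents never cancel. *)
Lemma word_eval_syllables x y l (w : seq (nonzero D * bool)) :
    (forall l', l' \in l :: w -> l'.1 = x \/ l'.1 = y) -> reduced (l :: w) ->
  exists b k s, [/\ k != 0 /\ all (predC1 0) s, l.1 = (if b then x else y),
    (k < 0) = l.2 & nonzero_val (word_eval (l :: w)) =
      syllables (nonzero_val x) (nonzero_val y) b (k :: s)].
Proof.
have valE (l' : nonzero D * bool) z : l'.1 = z ->
    nonzero_val (if l'.2 then (l'.1^-1)%g else l'.1) = nonzero_val z ^ lsign l'.2.
  by case: l' => z' [] /= ->; rewrite ?exprN1 ?expr1z.
elim: w l => [|l' w IHw] l lP redw.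
  exists (l.1 == x), (lsign l.2), [::]; split.
  - by split=> //; case: (l.2).
  - by case: (lP l (mem_head _ _)) => ->; rewrite ?eqxx //; case: eqP.
  - by case: (l.2).
  rewrite /word_eval big_seq1 /= mulr1 (valE l l.1) //; congr (_ ^ _).
  by case: eqP => [->|] //; case: (lP l (mem_head _ _)) => ->.
have /andP[ll' redw'] : ~~ ((l.1 == l'.1) && (l.2 != l'.2)) && reduced (l' :: w).
  by [].
have [|b [k [s [[k0 s0] l'1 ksign ew]]]] := IHw l' _ redw'.
  by move=> l2 l2w; apply: lP; rewrite in_cons l2w orbT.
have -> : nonzero_val (word_eval [:: l, l' & w]) =
    nonzero_val (if l.2 then (l.1^-1)%g else l.1) *
    nonzero_val (word_eval (l' :: w)).
  by rewrite /word_eval big_cons.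
have Ux z : nonzero_val z \is a GRing.unit by apply: nonzero_valU.
rewrite ew; have [eql|neql] := eqVneq l.1 l'.1.
  have eqs : l.2 = l'.2 by move: ll'; rewrite eql eqxx /= negbK => /eqP.
  exists b, (lsign l.2 + k), s; split.
  - split=> //; move: ksign; rewrite -eqs; case: (l.2) => /=; lia.
  - by rewrite -l'1.
  - by move: ksign; rewrite -eqs; case: (l.2) => /=; lia.
  rewrite (valE l l'.1 eql) l'1 /= mulrA.
  congr (_ * _); rewrite (fun_if (@nonzero_val D)) exprzDr //.
  by case: (b); apply: Ux.
have l1 : l.1 = if ~~ b then x else y.
  move: neql; case: (lP l (mem_head _ _)) => ->; rewrite l'1.
    by case: (b); rewrite ?eqxx.
  by case: (b); rewrite ?eqxx.
exists (~~ b), (lsign l.2), (k :: s); split=> //.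
- by split; [case: (l.2)|rewrite /= k0].
- by case: (l.2).
rewrite (valE l _ l1) /= negbK; congr (_ ^ _ * _).
by case: (b).
Qed.

Lemma free_pair_group x y (N : set (nonzero D)) :
    is_subgroup N -> N x -> N y -> free_pair (nonzero_val x) (nonzero_val y) ->
  exists H : set (nonzero D),
    [/\ is_subgroup H, (H `<=` N)%classic, ~ abelian_set H & is_free H].
Proof.
move=> sN Nx Ny xy_free; pose X : set (nonzero D) := [set x; y]%classic.
exists (generated X); split.
- exact: generated_subgroup.
- by apply: generated_min => // z [->|->].
- move=> abH; have : commute x y.
    by apply: abH; apply: sub_generated; [left|right].
  rewrite /commute => xy.
  have [Ux Uy] := (nonzero_valU x, nonzero_valU y).
  (* The commutator of [x] and [y], written in pairs. *)
  apply: (xy_free [:: (1, 1); (-1, -1)]) => //.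
  rewrite big_cons big_seq1 /= !expr1z !exprN1.
  have := congr1 (@nonzero_val D) xy; rewrite /= => ->.
  by rewrite mulrA mulrK // mulrV.
exists X; split=> // -[|l w] // wX redw _ w1.
have [|b [k [s [[k0 s0] _ _ ew]]]] := word_eval_syllables (x := x) (y := y) _ redw.
  by move=> l' /wX[->|->]; [left|right].
suff : syllables (nonzero_val x) (nonzero_val y) b (k :: s) <> 1.
  by apply; rewrite -ew w1.
by apply: free_pair_syllables; rewrite ?nonzeroP //= k0.
Qed.

End FreeGroup.

(** * Bicentralizers of commuting sets *)

Section Centralizer.
Variables (D : divisionRingType) (S : set D).

Definition centralizer : {pred D} := fun x => `[< forall z, S z -> x * z = z * x >].

Lemma centralizerP x : reflect (forall z, S z -> x * z = z * x) (x \in centralizer).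
Proof. exact: asboolP. Qed.

Fact centralizer_divring_closed : divring_closed centralizer.
Proof.
split.
- by apply/centralizerP => z _; rewrite mul1r mulr1.
- move=> x y /centralizerP cx /centralizerP cy; apply/centralizerP => z Sz.
  by rewrite mulrBl mulrBr cx // cy.
move=> x y /centralizerP cx /centralizerP cy; apply/centralizerP => z Sz.
have [->|/nonzero_unit Uy] := eqVneq y 0; first by rewrite invr0 mulr0 mul0r mulr0.
rewrite [RHS]mulrA -cx // -!mulrA; congr (_ * _).
by apply: (mulrI Uy); rewrite mulVKr // mulrA cy // mulrK.
Qed.

HB.instance Definition _ := GRing.isDivringClosed.Build D centralizer
  centralizer_divring_closed.
End Centralizer.

Definition commuting (D : divisionRingType) (S : set D) : Prop :=
  forall x y, S x -> S y -> x * y = y * x.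

Section Bicentralizer.
Variables (D : divisionRingType) (S : set D).

(** For commuting [S] this is a commutative field containing [S] and the center; the field theory
    above is applied in it. *)
Definition bicentralizer : {pred D} := centralizer [set x | x \in centralizer S].
HB.instance Definition _ := GRing.DivringClosed.on bicentralizer.

Record bicent (hS : commuting S) :=
  Bicent { bicent_val : D; bicentP : bicent_val \in bicentralizer }.

Variable hS : commuting S.
HB.instance Definition _ := [isSub of bicent hS for @bicent_val hS].
HB.instance Definition _ := [Choice of bicent hS by <:].
HB.instance Definition _ := [SubChoice_isSubUnitRing of bicent hS by <:].

Lemma sub_bicentralizer x : S x -> x \in bicentralizer.
Proof. by move=> Sx; apply/centralizerP => z /centralizerP ->. Qed.

Lemma bicentralizer_sub x : x \in bicentralizer -> x \in centralizer S.
Proof.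
move=> /centralizerP xC; apply/centralizerP => z Sz; apply: xC.
by apply/centralizerP => w Sw; exact: hS.
Qed.

Fact bicent_mulC : commutative (@GRing.mul (bicent hS)).
Proof.
move=> x y; apply/val_inj; rewrite !rmorphM /=.
by have /centralizerP := bicentP x; apply; exact: bicentralizer_sub (bicentP y).
Qed.
HB.instance Definition _ := GRing.PzRing_hasCommutativeMul.Build (bicent hS) bicent_mulC.

Fact bicent_field : GRing.field_axiom (bicent hS).
Proof. by move=> x; rewrite -(inj_eq val_inj) rmorph0 => /nonzero_unit. Qed.
HB.instance Definition _ := GRing.ComUnitRing_isField.Build (bicent hS) bicent_field.

Definition bicent_center (z : center D) : bicent hS.
Proof.
exists (center_val z); apply/centralizerP => w _.
exact: (asboolW (centerP z)).
Defined.

Fact bicent_center_zmod : zmod_morphism bicent_center.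
Proof. by move=> x y; apply: val_inj. Qed.
Fact bicent_center_monoid : monoid_morphism bicent_center.
Proof.
by split=> [|x y]; apply: val_inj.
Qed.
HB.instance Definition _ := GRing.isZmodMorphism.Build (center D) (bicent hS)
  bicent_center bicent_center_zmod.
HB.instance Definition _ := GRing.isMonoidMorphism.Build (center D) (bicent hS)
  bicent_center bicent_center_monoid.

Section Conjugation.
Variable y : D.
Hypothesis Uy : y \is a GRing.unit.
Hypothesis yS : forall (i : int) w, S w -> S (y ^ i * w * y ^ (- i)).

(** Conjugation by powers of [y] preserves [S], hence its centralizer, hence the bicentralizer. *)
Lemma conj_bicentralizer i x :
  x \in bicentralizer -> y ^ i * x * y ^ (- i) \in bicentralizer.
Proof.
have yV j : y ^ j * y ^ (- j) = 1 by rewrite -exprzDr // subrr.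
have yV' j : y ^ (- j) * y ^ j = 1 by rewrite -exprzDr // addNr.
move=> /centralizerP xC; apply/centralizerP => z /centralizerP zC.
have := xC (y ^ (- i) * z * y ^ i) _.
have zi : y ^ (- i) * z * y ^ i \in centralizer S.
  apply/centralizerP => w Sw; have := zC _ (yS i Sw).
  move=> /(congr1 (fun v => y ^ (- i) * v * y ^ i)).
  by rewrite !mulrA yV' mul1r -!mulrA yV' mulr1.
move=> /(_ zi) /(congr1 (fun v => y ^ i * v * y ^ (- i))).
by rewrite !mulrA yV mul1r -!mulrA yV mulr1.
Qed.

Definition bicent_conj (i : int) (x : bicent hS) : bicent hS :=
  Bicent hS (conj_bicentralizer i (bicentP x)).

Fact bicent_conj_zmod i : zmod_morphism (bicent_conj i).
Proof.
move=> u v; apply: val_inj.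
transitivity (y ^ i * (val u - val v) * y ^ (- i)); first by [].
by rewrite mulrBr mulrBl.
Qed.
Fact bicent_conj_monoid i : monoid_morphism (bicent_conj i).
Proof.
split.
  by apply: val_inj; rewrite /= mulr1 -exprzDr // subrr.
move=> u v; apply: val_inj.
transitivity (y ^ i * (val u * val v) * y ^ (- i)); first by [].
transitivity (y ^ i * val u * y ^ (- i) * (y ^ i * val v * y ^ (- i))); last by [].
rewrite !mulrA -[y ^ i * val u * _ * y ^ i]mulrA -exprzDr // addNr expr0z.
by rewrite mulr1.
Qed.
HB.instance Definition _ i := GRing.isZmodMorphism.Build (bicent hS) (bicent hS)
  (bicent_conj i) (bicent_conj_zmod i).
HB.instance Definition _ i := GRing.isMonoidMorphism.Build (bicent hS) (bicent hS)
  (bicent_conj i) (bicent_conj_monoid i).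

Lemma bicent_conj0 x : bicent_conj 0 x = x.
Proof. by apply: val_inj; rewrite /= oppr0 !expr0z mul1r mulr1. Qed.

Lemma bicent_conjD i j x : bicent_conj (i + j) x = bicent_conj i (bicent_conj j x).
Proof.
apply: val_inj; rewrite /= opprD addrC [- i - j]addrC [j + i]addrC.
by rewrite !exprzDr // !mulrA.
Qed.
End Conjugation.
End Bicentralizer.

(** * Free pairs in division rings *)

Section FreeFromSums.
Variables (D : divisionRingType) (L : divringClosed D) (Y : D).
Hypothesis tauL : forall u, u \in L -> Y * u * Y^-1 \in L.
Hypothesis Y_free : forall n (l : nat -> D), (forall i, l i \in L) ->
  \sum_(i < n) l i * Y ^+ i = 0 -> forall i : 'I_n, l i = 0.

(* Writing [h = Delta^-1 A Delta], one has
   [h^k = c + Delta^-1 (A^k - c)] with [c = Y^-1 A^k Y]. *)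
Lemma free_pair_Delta (A f : D) : A \in L -> f \in L -> A != 0 -> f != 0 ->
    Y^-1 * A * Y \in L ->
    (forall k l : int, k != 0 -> l != 0 ->
       ~ exact_form L Y ((A ^ k - Y^-1 * A ^ k * Y) * f ^ l)) ->
  free_pair ((1 - Y)^-1 * A * (1 - Y)) f.
Proof.
move=> AL fL /nonzero_unit UA /nonzero_unit Uf AYL nexact s sN sP.
have UY := Y_unit Y_free; have UDe := Delta_unit Y_free.
pose c k := Y^-1 * A ^ k * Y.
have rpredXz x (k : int) : x \in L -> x ^ k \in L.
  by move=> xL; case: k => n; rewrite ?rpredV rpredX.
have cL k : c k \in L.
  by rewrite /c -conj_exprz // rpredXz.
pose w := [seq (c p.1 * f ^ p.2, (A ^ p.1 - c p.1) * f ^ p.2) | p <- s].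
have -> : \prod_(p <- s) (((1 - Y)^-1 * A * (1 - Y)) ^ p.1 * f ^ p.2) =
    \prod_(p <- w) (p.1 + (1 - Y)^-1 * p.2).
  rewrite big_map; apply: eq_bigr => -[k l] _ /=.
  rewrite conj_exprz // [X in _ = _ + X]mulrA -mulrDl -[LHS]mulrA.
  rewrite [LHS]mulrA; congr (_ * _); rewrite -mulrA.
  have -> : A ^ k * (1 - Y) = (1 - Y) * c k + (A ^ k - c k).
    rewrite mulrBr mulrBl mul1r mulr1 /c !mulrA divrr // mul1r.
    by rewrite [RHS]addrC addrA subrK.
  by rewrite mulrDr mulrA mulVr // mul1r.
apply: (iterated_sums_neq1 tauL Y_free); first by rewrite /w; case: (s) sN.
move=> p /mapP[[k l] kl ->] /=; have /andP[k0 l0] := allP sP _ kl.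
split; last exact: nexact.
- by apply: rpredM; [exact: cL|exact: rpredXz].
by apply: rpredM; [apply: rpredB; [exact: rpredXz|exact: cL]|exact: rpredXz].
Qed.
End FreeFromSums.

Section SubfieldImage.
Variables (D : divisionRingType) (S : set D) (hS : commuting S).
Local Notation Om := (bicent hS).
Variables (L : set Om) (sL : is_subfield L).

Definition subfield_image of is_subfield L : {pred D} :=
  fun d => `[< exists2 u : Om, L u & val u = d >].

Lemma subfield_imageP d :
  reflect (exists2 u : Om, L u & val u = d) (d \in subfield_image sL).
Proof. exact: asboolP. Qed.

Fact subfield_image_divring_closed : divring_closed (subfield_image sL).
Proof.
have [L1 LB LV] := sL; split.
- by apply/subfield_imageP; exists 1.
- move=> _ _ /subfield_imageP[u Lu <-] /subfield_imageP[v Lv <-].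
  by apply/subfield_imageP; exists (u - v) => //; exact: LB.
move=> _ _ /subfield_imageP[u Lu <-] /subfield_imageP[v Lv <-].
apply/subfield_imageP; exists (u / v); first exact: LV.
have [->|v0] := eqVneq v 0.
  by rewrite invr0 mulr0 (rmorph0 (val : Om -> D)) invr0 mulr0.
by rewrite (rmorphM (val : Om -> D)) (rmorphV (val : Om -> D)) ?unitfE.
Qed.
HB.instance Definition _ := GRing.isDivringClosed.Build D (subfield_image sL)
  subfield_image_divring_closed.
End SubfieldImage.

Lemma acl_root (F : fieldType) (X : set F) (x : F) m :
  (0 < m)%N -> acl X (x ^+ m) -> acl X x.
Proof.
move=> m0 Xxm; apply: algebraic_over_acl.
exists ('X^m - (x ^+ m)%:P); split.
- by rewrite -size_poly_eq0 size_XnsubC.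
- have [X1 XB XV] := acl_subfield X.
  have X0 : acl X 0 by rewrite -(subrr 1); exact: XB.
  move=> i; rewrite coefB coefXn coefC; apply: XB; first by case: eqP.
  by case: eqP.
by rewrite rootE !hornerE subrr.
Qed.

Lemma adjoin_stable (F : fieldType) (K X : set F) (f : {rmorphism F -> F}) :
  (forall x, K x -> adjoin K X (f x)) -> (forall x, X x -> adjoin K X (f x)) ->
  forall x, adjoin K X x -> adjoin K X (f x).
Proof.
move=> Kf Xf; have [A1 AB AV] := adjoin_subfield K X.
suff : adjoin K X `<=` [set x | adjoin K X (f x)] by [].
apply: adjoin_min => //; split=> /=.
- by rewrite rmorph1.
- by move=> u v ? ?; rewrite rmorphB; exact: AB.
- by move=> u v ? ?; rewrite fmorph_div; exact: AV.
Qed.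

Lemma adjoin_fixed (F : fieldType) (K X : set F) (f : {rmorphism F -> F}) :
  (forall x, K x -> f x = x) -> (forall x, X x -> f x = x) ->
  forall x, adjoin K X x -> f x = x.
Proof.
move=> Kf Xf; suff : adjoin K X `<=` [set x | f x = x] by [].
apply: adjoin_min => //; split=> /=.
- by rewrite rmorph1.
- by move=> u v eu ev; rewrite rmorphB eu ev.
- by move=> u v eu ev; rewrite fmorph_div eu ev.
Qed.

Lemma conj_neq0 (D : divisionRingType) (g x : D) :
  g \is a GRing.unit -> x != 0 -> g * x * g^-1 != 0.
Proof.
move=> Ug x0; suff : g * x * g^-1 \is a GRing.unit.
  by apply: contraTneq => ->; rewrite unitr0.
by rewrite !unitrMl ?unitrV //; exact: nonzero_unit.
Qed.

(** * A free partner for the iterated commutators *)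

Section CommutingConjugates.
Variables (D : divisionRingType) (a y : D).
Hypothesis Uy : y \is a GRing.unit.
Local Notation conj i := (y ^ i * a * y ^ (- i)).
Hypothesis conj_comm : forall i j : int, conj i * conj j = conj j * conj i.
Hypothesis ya_neq : y * a != a * y.
Hypothesis F_trdeg : infinite_trdeg (prime_subfield (center D)).

(** Powers of [y] commuting with [a] are included so that [y ^ (i - j)] is available as a scalar
    when [y ^ i] and [y ^ j] act alike on [a]. *)
Let S : set D := [set w | (exists i : int, w = conj i) \/
                          (exists2 i : int, w = y ^ i & y ^ i * a = a * y ^ i)].

Lemma exprzC i j : y ^ i * y ^ j = y ^ j * y ^ i.
Proof. by rewrite -!exprzDr // addrC. Qed.

Lemma expz_conj i j : y ^ i * a = a * y ^ i -> y ^ i * conj j = conj j * y ^ i.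
Proof.
move=> ca; rewrite !mulrA exprzC -[_ * y ^ i * a]mulrA ca.
by rewrite -!mulrA exprzC.
Qed.

Lemma S_commuting : commuting S.
Proof.
move=> _ _ [[i ->]|[i -> ca]] [[j ->]|[j -> ca']].
- exact: conj_comm.
- by rewrite expz_conj.
- by rewrite expz_conj.
- exact: exprzC.
Qed.

Lemma S_conj (i : int) w : S w -> S (y ^ i * w * y ^ (- i)).
Proof.
case=> [[j ->]|[j -> ca]].
  left; exists (i + j); rewrite opprD [- i - j]addrC !exprzDr //.
  by rewrite !mulrA.
right; exists j => //.
by rewrite exprzC -mulrA -exprzDr // subrr mulr1.
Qed.

Local Notation Om := (bicent S_commuting).
Let phi (i : int) : {rmorphism Om -> Om} :=
  @bicent_conj D S S_commuting y Uy S_conj i.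
Local Notation iota := (bicent_center S_commuting).

Let phi0 (x : Om) : phi 0 x = x. Proof. exact: bicent_conj0. Qed.
Let phiD i j (x : Om) : phi (i + j) x = phi i (phi j x).
Proof. exact: bicent_conjD. Qed.

Let phi_iota i (t : center D) : phi i (iota t) = iota t.
Proof.
apply: val_inj => /=; have ct z : center_val t * z = z * center_val t.
  exact: (asboolW (centerP t)).
by rewrite -ct -mulrA -exprzDr // subrr mulr1.
Qed.

Definition bicent_a : Om :=
  Bicent S_commuting
    (sub_bicentralizer (or_introl (ex_intro _ 0 erefl) : S (conj 0))).

Local Notation aO := bicent_a.

Let val_orb i : val (phi i aO) = conj i.
Proof. by rewrite /= oppr0 expr0z mul1r mulr1. Qed.

Let phi1a : phi 1 aO != aO.
Proof.
apply: contra_neq ya_neq => /(congr1 val); rewrite val_orb /= oppr0 expr0z mul1r mulr1.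
by rewrite expr1z exprN1 => /(congr1 (fun v => v * y)); rewrite mulrVK.
Qed.

Let orbit : set Om := [set x | exists i, x = phi i aO].
Let SO : set Om := [set x | S (val x)].
Let K : set Om := adjoin set0 SO.

(* Up to algebraic elements, [SO] is the orbit of [a] together with at most one
   power of [y]. *)
Lemma sub_SO_acl : exists zs : seq Om,
  (forall i x, x \in zs -> phi i x = x) /\ SO `<=` acl (orbit `|` [set` zs]).
Proof.
have [[m m0 ca]|nm] :=
  pselect (exists2 m : nat, (0 < m)%N & y ^ m%:Z * a = a * y ^ m%:Z).
  have Sm : S (y ^ m%:Z) by right; exists m%:Z.
  pose z : Om := Bicent S_commuting (sub_bicentralizer Sm).
  exists [:: z]; split.
    move=> i x; rewrite inE => /eqP ->; apply: val_inj => /=.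
    by rewrite exprzC -mulrA -exprzDr // subrr mulr1.
  have [X1 XB XV] := acl_subfield (orbit `|` [set` [:: z]]).
  move=> x [[i ex]|[i ex cax]].
    by apply: sub_acl; left; exists i; apply: val_inj; rewrite val_orb.
  (* Here [x] is [y ^ i] and [z] is [y ^ m], so [x] is an [m]-th root of a power of [z]. *)
  apply: (acl_root m0); have -> : x ^+ m = z ^ i.
    apply: val_inj; transitivity ((val x) ^+ m).
      exact: (rmorphXn (val : Om -> D)).
    rewrite ex.
    have -> : val (z ^ i) = (y ^ m%:Z) ^ i.
      case: (i) => n; first by rewrite -exprnP (rmorphXn (val : Om -> D)).
      rewrite NegzE -!exprnN -!exprVn (rmorphXn (val : Om -> D)).
      congr (_ ^+ _); transitivity ((val z)^-1) => //.
      by rewrite exprVn.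
    by rewrite exprnP !exprz_exp mulrC.
  have zX : acl (orbit `|` [set` [:: z]]) z by apply: sub_acl; right; rewrite /= inE.
  have zn n : acl (orbit `|` [set` [:: z]]) (z ^+ n).
    elim: n => [|n IHn]; first by rewrite expr0.
    rewrite exprSr -[z in _ * z]invrK; apply: (XV _ _) => //.
    by rewrite -[z^-1]mul1r; apply: (XV _ _).
  case: i {ex cax} => n; first exact: zn.
  by rewrite NegzE -exprnN -[_^-1]mul1r; apply: (XV _ _).
exists [::]; split=> // x [[i ex]|[i ex cax]].
  by apply: sub_acl; left; exists i; apply: val_inj; rewrite val_orb.
have i0 : i = 0.
  apply: contra_notP nm => /eqP i0; exists `|i|%N; first by rewrite absz_gt0.
  case: i cax {ex} i0 => n cax _ //.
  move: cax; rewrite NegzE /= => cax.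
  have Uyn : y ^ n.+1%:Z \is a GRing.unit by rewrite unitrXz.
  apply: (mulrI (x := y ^ - n.+1%:Z)); first by rewrite unitrXz.
  rewrite mulrA -exprzDr // addNr mul1r mulrA cax -mulrA -exprzDr // addNr.
  by rewrite mulr1.
have -> : x = 1 by apply: val_inj; rewrite ex i0.
by have [] := acl_subfield (orbit `|` [set` [::] : seq Om]).
Qed.

Let Fx : set Om := [set x | exists t, x = iota t].

Let Fx_fixed i x : Fx x -> phi i x = x.
Proof. by move=> [t ->]; exact: phi_iota. Qed.

Let Fx_infinite (s : seq Om) : exists t, Fx t /\ ~ acl [set` s] t.
Proof.
have [t nt] := infinite_trdeg_not_finite iota s F_trdeg.
by exists (iota t); split=> //; exists t.
Qed.

Lemma phi_K i x : K x -> K (phi i x).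
Proof.
apply: adjoin_stable => // z Sz; apply: sub_adjoinr; rewrite /SO /=.
exact: S_conj.
Qed.

Lemma val_phi i (x : Om) : val (phi i x) = y ^ i * val x * y ^ (- i).
Proof. by []. Qed.

Lemma phi_periodic m x : phi m aO = aO -> K x -> phi m x = x.
Proof.
move=> am; apply: adjoin_fixed => // z [[i ez]|[i ez _]]; last first.
  by apply: val_inj; rewrite val_phi ez exprzC -mulrA -exprzDr // subrr mulr1.
have -> : z = phi i aO by apply: val_inj; rewrite val_orb.
by rewrite -phiD addrC phiD am.
Qed.

(** Each element found is fixed by all [phi i], so it can join the finite list to which
    [orbit_transcendental] is applied next. *)
Lemma exists_transcendentals : exists s1 s2 t : Om,
  [/\ Fx s1, Fx s2 & Fx t] /\
  [/\ ~ algebraic_over K s1, ~ algebraic_over (adjoin K [set s1]) s2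
    & ~ algebraic_over (adjoin (adjoin K [set s1]) [set s2]) t].
Proof.
have [zs [zs_fixed SOzs]] := sub_SO_acl.
have Kacl (r : seq Om) : {subset zs <= r} -> K `<=` acl (orbit `|` [set` r]).
  move=> zsr; apply: adjoin_min => //; first exact: acl_subfield.
  apply: (subset_trans SOzs); apply: aclS => x [ox|xz]; first by left.
  by right; apply: zsr.
have trans (r : seq Om) (t : Om) : {subset zs <= r} ->
    forall M : set Om, M `<=` acl (orbit `|` [set` r]) ->
    ~ acl (orbit `|` [set` r]) t -> ~ algebraic_over M t.
  move=> zsr M Mr nt Mt; apply: nt; apply: algebraic_over_acl.
  exact: algebraic_overS Mt.
have fixS (r : seq Om) (t : Om) : (forall i x, x \in r -> phi i x = x) -> Fx t ->
    forall i x, x \in t :: r -> phi i x = x.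
  by move=> r_fixed Ft i x; rewrite inE => /predU1P[->|/r_fixed //]; exact: Fx_fixed.
have adjS (r : seq Om) (t : Om) (M : set Om) : M `<=` acl (orbit `|` [set` r]) ->
    adjoin M [set t] `<=` acl (orbit `|` [set` t :: r]).
  move=> Mr; apply: adjoin_min; first exact: acl_subfield.
    apply: (subset_trans Mr); apply: aclS => x [ox|xr]; first by left.
    by right; rewrite /= inE xr orbT.
  by move=> _ ->; apply: sub_acl; right; rewrite /= mem_head.
have sub (r : seq Om) (t : Om) : {subset zs <= r} -> {subset zs <= t :: r}.
  by move=> zsr x /zsr xr; rewrite inE xr orbT.
have tr := orbit_transcendental phi0 phiD Fx_fixed Fx_infinite aO.
have [s1 [Fs1 ns1]] := tr _ zs_fixed.
have fix1 := fixS _ _ zs_fixed Fs1.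
have [s2 [Fs2 ns2]] := tr _ fix1.
have fix2 := fixS _ _ fix1 Fs2.
have [t [Ft nt]] := tr _ fix2.
have zs0 : {subset zs <= zs} by [].
have K0 := Kacl _ zs0; have K1 := adjS _ s1 _ K0; have K2 := adjS _ s2 _ K1.
exists s1, s2, t; do 2!split=> //.
- exact: (trans zs).
- by apply: (trans (s1 :: zs)) => //; exact: sub.
- by apply: (trans [:: s2, s1 & zs]) => //; apply: (sub (s1 :: zs)); exact: sub.
Qed.

(** Each step is the commutator of the previous term with [y], hence goes one step down a subnormal
    series. *)
Fixpoint conj_quotient (x : D) n : D :=
  if n is n'.+1 then conj_quotient x n' / (y * conj_quotient x n' * y^-1) else x.

Section Independence.
Variables (L : set Om) (sL : is_subfield L).
Hypothesis KL : K `<=` L.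
Hypothesis phiL : forall i x, L x -> L (phi i x).
Variable t : Om.
Hypothesis Ft : Fx t.
Hypothesis t_transcendental : ~ algebraic_over L t.

Lemma val_exprz (x : Om) (i : int) : val (x ^ i) = val x ^ i.
Proof.
case: i => n; first exact: (rmorphXn (val : Om -> D)).
have [->|x0] := eqVneq x 0; first by rewrite NegzE -!exprnN !exprS !mul0r !invr0.
transitivity ((val (x ^+ n.+1))^-1).
  by apply: (rmorphV (val : Om -> D)); rewrite unitfE expf_neq0.
by rewrite (rmorphXn (val : Om -> D)).
Qed.

(* A relation of minimal support only involves powers of [y] inducing the same
   automorphism of [L], hence is a polynomial relation for [t] over [L]. *)
Lemma powers_free n (l : nat -> Om) : (forall i, L (l i)) ->
  \sum_(i < n) val (l i) * (val t * y) ^+ i = 0 -> forall i : 'I_n, l i = 0.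
Proof.
have tC (z : D) : val t * z = z * val t.
  by have [c ->] := Ft; exact: (asboolW (centerP c)).
have tXC k (z : D) : val t ^+ k * z = z * val t ^+ k.
  have zt : GRing.comm z (val t) by rewrite /GRing.comm tC.
  exact/esym/(commrX k zt).
have tyX k : (val t * y) ^+ k = val t ^+ k * y ^+ k.
  by rewrite exprMn_comm //; exact: tC.
have [N] := ubnP #|[pred i : 'I_n | l i != 0]|.
elim: N l => // N IHN l ltN lL sum0 i0; apply/eqP; apply: contraT => li0.
have phi_y j (k : Om) : val (phi j%:Z k) * y ^+ j = y ^+ j * val k.
  by rewrite val_phi -exprnN -exprnP mulrVK // unitrX.
have phi_ty j (k : Om) :
    val (phi j%:Z k) * (val t * y) ^+ j = (val t * y) ^+ j * val k.
  by rewrite tyX mulrA -tXC -mulrA phi_y mulrA.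
have mulL u v : L u -> L v -> L (u * v).
  have [L1 _ LV] := sL; move=> Lu Lv; rewrite -[v]invrK; apply: (LV _ _) => //.
  by rewrite -[v^-1]mul1r; apply: (LV _ _).
have subL u v : L u -> L v -> L (u - v) by have [_ LB _] := sL; exact: LB.
(* Twisting the coefficients by a scalar [k] kills the one of index [i0]; the shorter relation
   vanishes by induction. *)
have phi_eq (i : 'I_n) k : l i != 0 -> L k -> phi i%:Z k = phi i0%:Z k.
  move=> li Lk; pose l' j := l j * (phi i0%:Z k - phi j%:Z k).
  have : l' i = 0.
    apply: (IHN l') => [|j|].
    - rewrite ltnS in ltN; apply: leq_trans ltN.
      apply: proper_card; apply/properP; split.
        apply/fintype.subsetP => j; rewrite !inE.
        by apply: contra_neq => lj; rewrite /l' lj mul0r.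
      by exists i0; rewrite !inE // /l' subrr mulr0 eqxx.
    - by apply: mulL => //; apply: subL; exact: phiL.
    transitivity (val (phi i0%:Z k) * (\sum_(j < n) val (l j) * (val t * y) ^+ j)
        - (\sum_(j < n) val (l j) * (val t * y) ^+ j) * val k).
      rewrite mulr_sumr mulr_suml -sumrB; apply: eq_bigr => j _.
      have -> : val (l' j) =
          val (phi i0%:Z k) * val (l j) - val (l j) * val (phi j%:Z k).
        rewrite /l' mulrBr [l j * phi i0%:Z k]mulrC.
        by rewrite (rmorphB (val : Om -> D)) !(rmorphM (val : Om -> D)).
      rewrite mulrBl; congr (_ - _); first by rewrite mulrA.
      by rewrite -[LHS]mulrA phi_ty mulrA.
    by rewrite sum0 mulr0 mul0r subr0.
  by move=> /eqP; rewrite mulf_eq0 (negPf li) subr_eq0 => /eqP.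
have LaO : L aO by apply: KL; apply: sub_adjoinr; left; exists 0.
(* On the support [y ^ i] and [y ^ i0] act alike on [a], so [y ^ (i - i0)] is in [K]; off the
   support [aO] is a dummy value. *)
have /choice[mu muP] : forall i : nat, exists m : Om, L m /\
    ((i < n)%N -> l i != 0 -> val m = y ^ (i%:Z - i0%:Z)).
  move=> i; have [/andP[ltin li]|nlt] := boolP ((i < n)%N && (l i != 0)); last first.
    by exists aO; split=> // h1 h2; rewrite h1 h2 in nlt.
  have /(congr1 val) := phi_eq (Ordinal ltin) aO li LaO.
  rewrite !val_orb /= => econj.
  have Sm : S (y ^ (i%:Z - i0%:Z)).
    right; exists (i%:Z - i0%:Z) => //; rewrite addrC exprzDr //.
    have Ui0 : y ^ i0%:Z \is a GRing.unit by rewrite unitrXz.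
    have Ui : y ^ (- i%:Z) \is a GRing.unit by rewrite unitrXz.
    apply: (mulrI Ui0); apply: (mulIr Ui); rewrite !mulrA -exprzDr // subrr mul1r econj.
    by rewrite -[RHS]mulrA -exprzDr // subrr mulr1.
  exists (Bicent S_commuting (sub_bicentralizer Sm)); split=> //.
  by apply: KL; apply: sub_adjoinr.
(* Multiplying [p.[t]] on the right by [y ^ i0] gives back the relation. *)
pose p := \poly_(i < n) (l i * mu i).
have pt : p.[t] = 0.
  have Ui0 : y ^+ i0 \is a GRing.unit by rewrite unitrX.
  apply: val_inj; apply: (mulIr Ui0); rewrite (rmorph0 (val : Om -> D)) mul0r -[RHS]sum0.
  rewrite horner_poly (rmorph_sum (val : Om -> D)) mulr_suml; apply: eq_bigr => i _.
  rewrite !(rmorphM (val : Om -> D)) (rmorphXn (val : Om -> D)).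
  have [->|li] := eqVneq (l i) 0; first by rewrite (rmorph0 (val : Om -> D)) !mul0r.
  have [_ /(_ (ltn_ord i) li) emu] := muP i.
  transitivity (val (l i) * y ^ (i%:Z - i0%:Z) * val t ^+ i * y ^+ i0).
    by rewrite -emu.
  rewrite tyX -!mulrA; congr (_ * _).
  by rewrite [LHS]mulrA -tXC -mulrA; congr (_ * _); rewrite !exprnP -exprzDr // subrK.
have p0 : p = 0.
  apply: contra_notP t_transcendental => /eqP p0; exists p; split=> //.
    move=> i; rewrite coef_poly; case: ifP => _.
      by apply: mulL; [exact: lL|have [] := muP i].
    by rewrite -(subrr aO); exact: subL.
  exact/rootP.
have := congr1 (fun q : {poly Om} => q`_i0) p0.
rewrite coef_poly ltn_ord coef0 => /eqP; rewrite mulf_eq0 (negPf li0) /= => /eqP mu0.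
have [_ /(_ (ltn_ord i0) li0)] := muP i0; rewrite mu0 subrr expr0z.
by rewrite (rmorph0 (val : Om -> D)) => /esym/eqP; rewrite oner_eq0.
Qed.
End Independence.

Lemma val_iterated_quotient s1 n :
  val (iterated_quotient phi s1 aO n) = conj_quotient (val s1 - a) n.
Proof.
elim: n => [|n IHn].
  transitivity (val s1 - val aO); first by [].
  by rewrite /= oppr0 expr0z mul1r mulr1.
rewrite [RHS]/= -IHn [iterated_quotient _ _ _ _]/=.
move: (iterated_quotient _ _ _ n) => x.
have [->|x0] := eqVneq x 0.
  by rewrite mul0r (rmorph0 (val : Om -> D)) mul0r.
rewrite (rmorphM (val : Om -> D)); congr (_ * _).
Qed.

(** One central [c] serves all [n]: the length of the series is used for the free pair, and [n = 0]
    for [c - a != 0]. *)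
Theorem exists_free_partner : exists2 c : D, c \in @central D & forall n,
  conj_quotient (c - a) n != 0 /\
  exists2 h, h != 0 & free_pair (conj_quotient (c - a) n) h.
Proof.
have [s1 [s2 [t [[Fs1 Fs2 Ft] [tr1 tr2 tr3]]]]] := exists_transcendentals.
exists (val s1); first by case: Fs1 => c ->; exact: centerP.
have sK : is_subfield K by exact: adjoin_subfield.
set K1 := adjoin K [set s1] in tr2 tr3; set L := adjoin K1 [set s2] in tr3.
have sK1 : is_subfield K1 by exact: adjoin_subfield.
have sL : is_subfield L by exact: adjoin_subfield.
have KK1 : K `<=` K1 by exact: sub_adjoinl.
have K1L : K1 `<=` L by exact: sub_adjoinl.
have phiK1 i x : K1 x -> K1 (phi i x).
  apply: adjoin_stable => [z Kz|_ ->]; first exact: (KK1 _ (phi_K i Kz)).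
  by rewrite Fx_fixed //; exact: sub_adjoinr.
have phiL i x : L x -> L (phi i x).
  apply: adjoin_stable => [z Kz|_ ->]; first exact: (K1L _ (phiK1 _ _ Kz)).
  by rewrite Fx_fixed //; exact: sub_adjoinr.
have fixL m x : phi m aO = aO -> L x -> phi m x = x.
  move=> am; apply: adjoin_fixed => [z|_ ->]; last exact: Fx_fixed.
  apply: adjoin_fixed => [{}z Kz|_ ->]; last exact: Fx_fixed.
  exact: phi_periodic.
have Ka : K aO by apply: sub_adjoinr; left; exists 0.
have LP u : L u -> val u \in subfield_image sL.
  by move=> Lu; apply/subfield_imageP; exists u.
move=> n; rewrite -val_iterated_quotient.
set A := iterated_quotient phi s1 aO n.
have Ator k : k != 0 -> A ^ k != phi 1 A ^ k.
  by move=> k0; apply/eqP; exact: (iterated_quotient_non_torsion phi0 phiD sK phi_K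
    (fun i => Fx_fixed i Fs1) tr1 Ka).
have A0 : A != 0.
  by apply: contra_neq (Ator 1 isT) => ->; rewrite rmorph0.
have K1a : K1 aO := KK1 _ Ka.
have K1a1 : K1 (phi 1 aO) := phiK1 1 _ K1a.
have K1A : K1 A.
  have [_ K1B K1V] := sK1; rewrite /A; elim: (n) => [|m IHm] /=.
    by apply: (K1B _ _) => //; exact: sub_adjoinr.
  by apply: K1V => //; exact: phiK1.
have vA0 : val A != 0 by rewrite -(rmorph0 (val : Om -> D)) (inj_eq val_inj).
split=> //.
(* A zero at [aO] and a pole at [phi 1 aO], in the variable [s2] over [K1]. *)
pose f := (s2 - aO) / (s2 - phi 1 aO).
have sub_neq0 x : K1 x -> s2 - x != 0.
  by move=> K1x; exact: (sub_transcendental_neq0 sK1 tr2 K1x).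
have f0 : f != 0 by rewrite mulf_neq0 ?invr_neq0 // sub_neq0.
have Lf : L f.
  have [_ LB LV] := sL; apply: (LV _ _); apply: (LB _ _).
  - exact: sub_adjoinr.
  - exact: K1L.
  - exact: sub_adjoinr.
  - exact: K1L.
have vf0 : val f != 0 by rewrite -(rmorph0 (val : Om -> D)) (inj_eq val_inj).
pose Y := val t * y.
have tC z : val t * z = z * val t.
  by case: Ft => c ->; exact: (asboolW (centerP c)).
have Yfree m (l : nat -> D) : (forall i, l i \in subfield_image sL) ->
    \sum_(i < m) l i * Y ^+ i = 0 -> forall i : 'I_m, l i = 0.
  move=> lL; have /choice[l' l'P] : forall i, exists u : Om, L u /\ val u = l i.
    by move=> i; have /subfield_imageP[u Lu eu] := lL i; exists u.
  move=> sum0 i; have := @powers_free L sL (subset_trans KK1 K1L) phiL t Ft tr3 m l'.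
  move=> /(_ (fun i => proj1 (l'P i))) h; have [_ <-] := l'P i.
  rewrite h ?(rmorph0 (val : Om -> D)) // -[RHS]sum0.
  by apply: eq_bigr => j _; have [_ ->] := l'P j.
have UY := Y_unit Yfree.
have tu : val t \is a GRing.unit.
  apply/nonzero_unit/eqP => t0; move: UY; rewrite /Y t0 mul0r unitr0 //.
have YV : Y^-1 = y^-1 * (val t)^-1 by rewrite invrM.
have tVC z : (val t)^-1 * z = z * (val t)^-1.
  by apply: (mulrI tu); rewrite mulVKr // mulrA tC mulrK.
have conjY u : Y * val u * Y^-1 = val (phi 1 u).
  rewrite val_phi expr1z exprN1 YV /Y tC -!mulrA; congr (_ * _).
  by rewrite mulrA tC -!mulrA; congr (_ * _); rewrite -tVC mulVKr.
have conjVY u : Y^-1 * val u * Y = val (phi (- 1) u).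
  have e : Y * val (phi (- 1) u) * Y^-1 = val u by rewrite conjY -phiD subrr phi0.
  rewrite -[in LHS]e; move: (val (phi (- 1) u)) => v.
  by rewrite -(mulrA Y) mulKr // mulrVK.
pose De := 1 - Y; have UDe : De \is a GRing.unit := Delta_unit Yfree.
have De0 : De != 0 by apply: contraTneq UDe => ->; rewrite unitr0.
(* The free pair of [free_pair_Delta] is conjugated so that its first member becomes [val A]. *)
exists (De * val f * De^-1); first exact: conj_neq0.
suff hf : free_pair (De^-1 * val A * De) (val f).
  have h0 : De^-1 * val A * De != 0.
    by have := @conj_neq0 D De^-1 (val A); rewrite unitrV invrK; apply.
  have Dei0 : De^-1 != 0 by rewrite invr_eq0.
  have := free_pair_conj Dei0 h0 vf0 hf; rewrite invrK.
  by rewrite -(mulrA De^-1) mulVKr // mulrK.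
apply: (free_pair_Delta (L := subfield_image sL)) => //.
- by move=> _ /subfield_imageP[u Lu <-]; rewrite conjY; exact: (LP _ (phiL _ _ Lu)).
- exact: (LP _ (K1L _ K1A)).
- exact: LP.
- by rewrite conjVY; exact: (LP _ (phiL _ _ (K1L _ K1A))).
move=> k l k0 l0 [_ /subfield_imageP[u Lu <-]].
rewrite conjY -val_exprz conjVY -val_exprz => eqv.
pose g := A ^ k - phi (-1) (A ^ k).
have K1g : K1 g.
  have K1Ak : K1 (A ^ k).
    by apply/(subfieldP sK1)/rpredXz/(subfieldP sK1).
  by have [_ K1B _] := sK1; apply: K1B => //; exact: phiK1.
have g0 : g != 0.
  rewrite subr_eq0; apply: contra_neq (Ator k k0) => e.
  by rewrite -(fmorphXz (phi 1)) {2}e -phiD addrN phi0.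
apply: (quotient_not_exact phi0 phiD sK1 phiK1 (fun i => Fx_fixed i Fs2) tr2 K1a Lu
  (fun m am => fixL m%:Z u am Lu) K1g g0 l0 phi1a).
by apply: val_inj; rewrite -/f -/g; exact: eqv.
Qed.
End CommutingConjugates.

(** * Subnormal subgroups *)

Section SolvableExtraction.
Local Open Scope group_scope.
Variable G : groupType.
Implicit Types (H : set G) (x y a : G).

Lemma derived_sub H : is_subgroup H -> derived H `<=` H.
Proof.
move=> sH; have [H1 HM HV] := sH; apply: generated_min => // _ [x [y [Hx Hy ->]]].
by rewrite /commg /conjg; do !(apply: (HM _ _)); rewrite //; apply: (HV _ _).
Qed.

Lemma commg_derived H x y : H x -> H y -> derived H [~ x, y].
Proof. by move=> Hx Hy; apply: sub_generated; exists x, y. Qed.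

Lemma abelian_set1 : abelian_set [set (1 : G)].
Proof. by move=> x y -> ->. Qed.

(* In the last non-abelian term of the derived series, take [a] in the derived
   subgroup if the latter is not central, and anywhere otherwise: both times
   the conjugates [a * [~ a, g]] of [a] commute. *)
Lemma solvable_commuting_conjugates H :
    is_subgroup H -> ~ abelian_set H -> solvable_set H ->
  exists H' a y, [/\ is_subgroup H', H' `<=` H, H' a, H' y & ~ commute a y] /\
    forall g h, H' g -> H' h -> commute (a ^ g) (a ^ h).
Proof.
move=> + + [n]; elim: n H => [|n IHn] H sH nabH.
  by move=> /= H1; case: nabH; rewrite H1; exact: abelian_set1.
rewrite iterSr => solH; have sD := generated_subgroup (G := G).
have [abD|nabD] := pselect (abelian_set (derived H)); last first.
  have [H' [a [y [[sH' H'D H'a H'y nay] H'P]]]] := IHn _ (sD _) nabD solH.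
  exists H', a, y; split=> //; split=> //.
  by apply: subset_trans H'D _; exact: derived_sub.
have conjE a g : a ^ g = a * [~ a, g] by rewrite /commg mulVKg.
have [_ DM _] := sD [set z | exists x y, [/\ H x, H y & z = [~ x, y]]].
have [[a [y [Da Hy nay]]]|Dcentral] :=
  pselect (exists a y, [/\ derived H a, H y & ~ commute a y]).
  have Ha := derived_sub sH Da.
  exists H, a, y; split; first by split.
  move=> g h Hg Hh; rewrite !conjE.
  by apply: abD; apply: DM => //; exact: commg_derived.
have {}Dcentral z x : derived H z -> H x -> commute z x.
  by move=> Dz Hx; apply: contrapT => nzx; apply: Dcentral; exists z, x.
have [a [y [Ha Hy nay]]] : exists a y, [/\ H a, H y & ~ commute a y].
  apply: contrapT => nex; apply: nabH => x y Hx Hy; apply: contrapT => nxy.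
  by apply: nex; exists x, y.
exists H, a, y; split; first by split.
move=> g h Hg Hh; rewrite !conjE /commute.
move: (commg_derived Ha Hg) (commg_derived Ha Hh).
move: [~ a, g] [~ a, h] => c d cg ch.
rewrite -!mulgA; congr (_ * _); rewrite !mulgA (Dcentral _ _ cg Ha) (Dcentral _ _ ch Ha).
by rewrite -!mulgA; congr (_ * _); apply: abD.
Qed.
End SolvableExtraction.

Section Subnormal.
Variables (D : divisionRingType) (n : nat) (S : nat -> set (nonzero D)).
Hypothesis S0 : S 0 = setT.
Hypothesis S_normal : forall i : nat, (i < n)%N -> is_normal (S i.+1) (S i).

Lemma subnormal_is_subgroup j : (j <= n)%N -> is_subgroup (S j).
Proof.
case: j => [_|j ltj]; first by rewrite S0.
by have [] := S_normal ltj.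
Qed.

Lemma subnormal_sub j : (j <= n)%N -> S n `<=` S j.
Proof.
suff sub k : (k <= n)%N -> S n `<=` S (n - k).
  by move=> lejn; rewrite -(subKn lejn); apply: sub; exact: leq_subr.
elim: k => [|k IHk] ltkn; first by rewrite subn0.
apply: subset_trans (IHk (ltnW ltkn)) _.
have lt : (n - k.+1 < n)%N by rewrite ltn_subrL (leq_trans _ ltkn).
by have [_ _ + _] := S_normal lt; rewrite -subSn // subSS.
Qed.

(** The commutator of [w] and [y] is a conjugate of [y] by an element of [S j] times [y^-1], and [y]
    is in [S j.+1]. *)
Lemma subnormal_conj_quotient (y x : nonzero D) : S n y -> forall j, (j <= n)%N ->
  exists2 w, S j w &
    nonzero_val w = conj_quotient (nonzero_val y) (nonzero_val x) j.
Proof.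
move=> Ny; elim=> [|j IHj] ltjn; first by exists x; rewrite // S0.
have [w Sw ew] := IHj (ltnW ltjn).
have [[_ SM SV] [_ _ SV'] _ SJ] := S_normal ltjn.
have Sy := subnormal_sub ltjn Ny.
exists (w * (y * w * y^-1)^-1)%g; last by rewrite /= -ew.
have -> : (w * (y * w * y^-1)^-1 = y ^ (w^-1) * y^-1)%g.
  by rewrite /conjg !invgM !invgK !mulgA.
by apply: SM; [apply: SJ; [|exact: SV']|exact: SV].
Qed.

(** Replacing [h'] by [x ^ h'] enters the next normal subgroup, which contains [x], and keeps the
    pair free. *)
Lemma subnormal_free_pair (x h : nonzero D) : S n x ->
    free_pair (nonzero_val x) (nonzero_val h) -> forall j, (j <= n)%N ->
  exists2 h', S j h' & free_pair (nonzero_val x) (nonzero_val h').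
Proof.
move=> Nx xh; elim=> [|j IHj] ltjn; first by exists h; rewrite // S0.
have [h' Sh' xh'] := IHj (ltnW ltjn).
have [_ _ _ SJ] := S_normal ltjn.
exists (x ^ h')%g; first by apply: SJ => //; exact: subnormal_sub Nx.
have -> : nonzero_val (x ^ h')%g =
    ((nonzero_val h')^-1 * nonzero_val x * nonzero_val h')%R.
  by rewrite /conjg /= mulrA.
by apply: free_pair_conjr => //; exact: nonzeroP.
Qed.
End Subnormal.

Theorem theorem4p1 (D : divisionRingType) (N : set (nonzero D))
    (N_subnormal : subnormal N)
    (N_solvable : exists H : set (nonzero D),
       [/\ is_subgroup H, H `<=` N, ~ abelian_set H & solvable_set H])
    (F_trdeg : infinite_trdeg (prime_subfield (center D))) :
  exists H : set (nonzero D),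
    [/\ is_subgroup H, H `<=` N, ~ abelian_set H & is_free H].
Proof.
have [n [S [S0 SN Snorm]]] := N_subnormal.
have [H [sH HN nabH solH]] := N_solvable.
have [H' [a [y [[sH' H'H H'a H'y nay] acomm]]]] :=
  solvable_commuting_conjugates sH nabH solH.
have Ny : S n y by rewrite SN; apply/HN/H'H.
have Uy := nonzero_valU y.
have powH' (i : int) : exists2 g, H' g & nonzero_val g = (nonzero_val y ^ i)%R.
  have [H1 HM HV] := sH'.
  have pown k : exists2 g, H' g & nonzero_val g = (nonzero_val y ^+ k)%R.
    elim: k => [|k [g Hg eg]]; first by exists 1%g.
    by exists (y * g)%g; [exact: HM|rewrite /= eg exprS].
  case: i => k; first exact: pown.
  have [g Hg eg] := pown k.+1.
  by exists g^-1%g; [exact: HV|rewrite /= eg].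
have conj_comm (i j : int) :
    (nonzero_val y ^ i * nonzero_val a * nonzero_val y ^ (- i) *
     (nonzero_val y ^ j * nonzero_val a * nonzero_val y ^ (- j)) =
     nonzero_val y ^ j * nonzero_val a * nonzero_val y ^ (- j) *
     (nonzero_val y ^ i * nonzero_val a * nonzero_val y ^ (- i)))%R.
  (* As [a ^ g] is [g^-1 * a * g], the element [g] is [y ^ (- k)]. *)
  have conjE k : exists2 g, H' g & nonzero_val (a ^ g)%g =
      (nonzero_val y ^ k * nonzero_val a * nonzero_val y ^ (- k))%R.
    have [g Hg eg] := powH' (- k)%R; exists g => //.
    by rewrite /conjg /= eg invr_expz opprK mulrA.
  have [g Hg <-] := conjE i; have [h Hh <-] := conjE j.
  exact: (congr1 (@nonzero_val D) (acomm g h Hg Hh)).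
have ya_neq : (nonzero_val y * nonzero_val a != nonzero_val a * nonzero_val y)%R.
  by apply/eqP => e; apply: nay; apply: val_inj.
have [c _ cP] := exists_free_partner Uy conj_comm ya_neq F_trdeg.
have [_ [h h0 Ah]] := cP n.
have ca0 : (c - nonzero_val a != 0)%R by have [] := cP 0.
have [w Sw ew] := subnormal_conj_quotient S0 Snorm (Nonzero ca0) Ny (leqnn n).
have wh : free_pair (nonzero_val w) (nonzero_val (Nonzero h0)) by rewrite ew.
have [h' Sh' wh'] := subnormal_free_pair S0 Snorm Sw wh (leqnn n).
rewrite -SN; apply: free_pair_group Sw Sh' wh'.
exact: (subnormal_is_subgroup S0 Snorm (leqnn n)).
Qed.
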